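(* Let $\mathcal{C}$ be the set of all bivariate copulas and let $\Upsilon:[-1,1]\to[0,\frac{27}{128}]$ be defined by $\Upsilon(-1)=0$, \[ \Upsilon(e)=(1+e)-2^{-1/3}(1+e)^{4/3},\qquad e\in[-\tfrac34,1], \] and, on $(-1,-\frac34)$, parametrically by \[ \Upsilon(e_b)=\frac{b^3(6b^2-15b+8)}{8(1-b)^2},\qquad\text{where } e_b=-1+\frac{b^3(2b^2-9b+8)}{8(1-b)^2},\qquad b\in(0,\tfrac12). \] Then \[ \{(\eta(C),\nu(C)):C\in\mathcal{C}\}=\{(e,n):\ -1\le e\le 1,\ |n-e|\le\Upsilon(e)\}. \] Moreover, for every $e\in[-1,1]$, exactly one copula $C$ with $\eta(C)=e$ satisfies $\nu(C)=e+\Upsilon(e)$, and its transpose $C^\top$ is the only copula with $\eta=e$ and $\nu=e-\Upsilon(e)$.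
   Context: A (bivariate) copula is (the restriction to $[0,1]^2$ of) a distribution function of a probability measure on $[0,1]^2$ with uniform marginals. For a copula $C$, its transpose is $C^\top(u,v)=C(v,u)$, Blest's rank correlation is $\nu(C)=24\int_0^1\int_0^1(1-u)\,C(u,v)\,du\,dv-2$, and the symmetrized Blest coefficient is $\eta(C)=\frac{\nu(C)+\nu(C^\top)}{2}=12\int_0^1\int_0^1(2-u-v)\,C(u,v)\,du\,dv-2$. The parametric definition of $\Upsilon$ on $(-1,-\frac34)$ is meaningful because $b\mapsto e_b$ is an increasing bijection from $(0,\frac12)$ onto $(-1,-\frac34)$. *)

(* Defs.v *)
From HB Require Import structures.
From mathcomp Require Import all_boot all_order all_algebra.
From mathcomp Require Import all_classical all_reals all_analysis.

Set Implicit Arguments.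
Unset Strict Implicit.
Unset Printing Implicit Defensive.

Import Order.TTheory GRing.Theory Num.Theory.

Local Open Scope classical_set_scope.
Local Open Scope ring_scope.

Definition joint_cdf (R : realType)
    (P : probability (measurableTypeR R * measurableTypeR R)%type R) (u v : R) : R :=
  fine (P (`]-oo, u] `*` `]-oo, v])).

Definition uniform_marginals (R : realType)
    (P : probability (measurableTypeR R * measurableTypeR R)%type R) : Prop :=
  forall A : set (measurableTypeR R), measurable A ->
    pushforward P fst A = uniform_prob (@ltr01 R) A /\
    pushforward P snd A = uniform_prob (@ltr01 R) A.

(* A copula is kept as the whole distribution function on R^2: it is determined
   by its restriction to the unit square, C u v being the value of C at the
   projection of (u, v) onto that square.  Hence equality of copulas as
   functions R -> R -> R is the same as equality on the unit square. *)
Definition copula (R : realType) : set (R -> R -> R) :=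
  [set C | exists P : probability (measurableTypeR R * measurableTypeR R)%type R,
     [/\ P (`[0, 1] `*` `[0, 1]) = 1%E, uniform_marginals P & C = joint_cdf P]].

Definition transpose (R : realType) (C : R -> R -> R) : R -> R -> R :=
  fun u v => C v u.

Definition blest (R : realType) (C : R -> R -> R) : R :=
  24 * (\int[@lebesgue_measure R]_(v in `[0, 1])
         \int[@lebesgue_measure R]_(u in `[0, 1]) ((1 - u) * C u v)) - 2.

Definition sym_blest (R : realType) (C : R -> R -> R) : R :=
  (blest C + blest (transpose C)) / 2.

Definition Upsilon_abscissa (R : realType) (b : R) : R :=
  - 1 + (b ^+ 3 * (2 * b ^+ 2 - 9 * b + 8)) / (8 * (1 - b) ^+ 2).

Definition Upsilon_ordinate (R : realType) (b : R) : R :=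
  (b ^+ 3 * (6 * b ^+ 2 - 15 * b + 8)) / (8 * (1 - b) ^+ 2).

(* On ]-1, -3/4[ the parameter b is the unique preimage of e under
   Upsilon_abscissa, which is an increasing bijection from ]0, 1/2[ onto
   ]-1, -3/4[; the default value 0 of xget is never taken there.
   Values outside [-1, 1] are irrelevant. *)
Definition Upsilon (R : realType) (e : R) : R :=
  if e == - 1 then 0
  else if - (3 / 4) <= e then
    (1 + e) - 2 `^ (- (1 / 3)) * (1 + e) `^ (4 / 3)
  else
    Upsilon_ordinate
      (xget 0 [set b : R | 0 < b < 1 / 2 /\ Upsilon_abscissa b = e]).

(* Main.v *)
Require Import Defs.
From HB Require Import structures.
From mathcomp Require Import all_boot all_order all_algebra.
From mathcomp Require Import all_classical all_reals all_analysis.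
From mathcomp Require Import measurable_realfun ring lra.

Set Implicit Arguments.
Unset Strict Implicit.
Unset Printing Implicit Defensive.

Import Order.TTheory GRing.Theory Num.Theory.
Import numFieldNormedType.Exports.

Local Open Scope classical_set_scope.
Local Open Scope ring_scope.

(* For (U, V) distributed according to C put x = 1 - U and y = 1 - V, which are
   again uniform.  Then nu(C) = 12 E[x^2 y] - 2, nu(C^T) = 12 E[x y^2] - 2, so
   that, for a given eta, maximising nu amounts to maximising E[c(x, y)] with
   c(x, y) = a x^2 y - b x y^2 and suitable multipliers a, b.  The mixed
   derivative 2 a x - 2 b y of c is positive below the line b y = a x and
   negative above it, hence the support of an optimal coupling is increasing
   below the line and decreasing above it.  It is a graph x = T y: when
   eta = 2 s^3 - 1 >= - 3/4, T is the shift y + (1 - s) up to s and 1 - y after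
   it; when eta = e_b, the support leaves the antidiagonal at (1 - b, b), goes
   down to the line along a segment reaching x = 1 at y = b / (2 (1 - b)), and
   comes back along a segment to (1 - b, 0).  Optimality is Kantorovich duality:
   with phi' x the partial derivative of c in x on the support,
   phi x - phi (T y) - (c (x, y) - c (T y, y)) is nonnegative, and up to null
   sets it vanishes only on the graph of T.  A coupling reaching the maximum
   therefore sits on this graph, and its law is determined.  The rest of the
   region is filled by mixtures of the maximal copula and its transpose. *)

(** * Dual certificates *)

Definition cubic_cost (R : realFieldType) (a b x y : R) :=
  a * (x ^+ 2 * y) - b * (x * y ^+ 2).

(* The dual potential in [y] is the one that makes the gap vanish on the graph
   of [T], namely [c (T y) y - phi (T y)]; it never has to be computed. *)
Definition duality_gap (R : realFieldType) (c : R -> R -> R) (T phi : R -> R) (x y : R) :=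
  phi x - phi (T y) - (c x y - c (T y) y).

(* The lines [x = x0] and [y = y0] are allowed in the zero set of the gap because
   they are null for every coupling of uniform variables. *)
Definition optimality_certificate (R : realFieldType) (c : R -> R -> R)
    (T phi : R -> R) (x0 y0 : R) :=
  forall x y : R, 0 <= x <= 1 -> 0 <= y <= 1 ->
    0 <= duality_gap c T phi x y /\
    (duality_gap c T phi x y = 0 -> [\/ x = T y, x = x0 | y = y0]).

(* The length [1 - x] is what makes [T] preserve the uniform distribution. *)
Definition superlevel_intervals (R : realFieldType) (T : R -> R) :=
  forall x : R, 0 <= x <= 1 -> exists p : R, [/\ 0 <= p, p + (1 - x) <= 1 &
    forall y : R, 0 <= y <= 1 -> (x <= T y) = (p <= y <= p + (1 - x))].

(* Up to the factor [L / 6], this is the integral over a segment of length [L]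
   of the product of two affine functions with end values [p0, p1] and [q0, q1];
   the gap at a point off the support is the gap at a point of a region already
   treated plus such an integral of two negative functions. *)
Definition affine_prod (R : realFieldType) (p0 p1 q0 q1 : R) :=
  2 * (p0 * q0) + p0 * q1 + p1 * q0 + 2 * (p1 * q1).

Lemma affine_prod_gt0 (R : realFieldType) (p0 p1 q0 q1 : R) :
  p0 < 0 -> p1 <= 0 -> q0 < 0 -> q1 <= 0 -> 0 < affine_prod p0 p1 q0 q1.
Proof.
move=> hp0 hp1 hq0 hq1.
have h1 : 0 < p0 * q0 by rewrite nmulr_rgt0.
have h2 : 0 <= p0 * q1 by rewrite mulr_le0// ltW.
have h3 : 0 <= p1 * q0 by rewrite mulr_le0// ltW.
have h4 : 0 <= p1 * q1 by rewrite mulr_le0.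
by rewrite /affine_prod; lra.
Qed.

(** * The shift support *)

Definition T_shift (R : realFieldType) (s y : R) :=
  if y <= s then y + (1 - s) else 1 - y.

(* The integral from [1 - s] to [x] of the partial derivative of [shift_cost s]
   in its first argument along the graph of [T_shift s]. *)
Definition phi_shift (R : realFieldType) (s x : R) : R :=
  if x <= 1 - s then
    2 * s * (3 * x ^+ 2 - 2 * x ^+ 3) + (3 - 2 * s) * (1 - x) ^+ 3
    - (2 * s * (3 * (1 - s) ^+ 2 - 2 * (1 - s) ^+ 3) + (3 - 2 * s) * s ^+ 3)
  else 2 * s * (2 * (x - (1 - s)) ^+ 3 + 3 * (1 - s) * (x - (1 - s)) ^+ 2)
    - (3 - 2 * s) * (x - (1 - s)) ^+ 3.

Lemma phi_shiftR (R : realFieldType) (s x : R) : 1 - s <= x ->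
  phi_shift s x =
  2 * s * (2 * (x - (1 - s)) ^+ 3 + 3 * (1 - s) * (x - (1 - s)) ^+ 2)
    - (3 - 2 * s) * (x - (1 - s)) ^+ 3.
Proof.
move=> h2; rewrite /phi_shift; case: leP => // h1.
have -> : x = 1 - s by lra.
by ring.
Qed.

(** On [[0, s]] the map is at least [1 - s], and beyond [s] it falls below. For [x <= 1 - s] the
    superlevel set is thus [[0, 1 - x]], and for larger [x] it is [[x - (1 - s), s]]; both have
    length [1 - x]. *)
Lemma T_shift_superlevel (R : realFieldType) (s : R) : 1 / 2 <= s <= 1 ->
  superlevel_intervals (T_shift s).
Proof.
move=> hs x hx; have [xd|xd] := leP x (1 - s).
  exists 0; split; [lra|lra|] => y hy; rewrite /T_shift; case: (leP y s) => ys.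
    have -> : x <= y + (1 - s) by lra.
    by apply/esym/andP; split; lra.
  by apply/idP/andP => [h|[h1 h2]]; [split|]; lra.
exists (x - (1 - s)); split; [lra|lra|] => y hy; rewrite /T_shift.
by case: (leP y s) => ys; apply/idP/andP => [h|[h1 h2]]; [split| |split|]; lra.
Qed.

(* The ratio of the multipliers is forced by the two values of the potential in
   [y] at [y = s], coming from the two branches of [T_shift s], being equal. *)
Definition shift_cost (R : realFieldType) (s : R) :=
  cubic_cost (6 * s) (3 * (3 - 2 * s)).

(** In this corner both [x] and [T_shift s y] are values of the increasing branch, so the gap is the
    square of [x - T_shift s y] times a sum of two nonnegative products. *)
Lemma shift_gap_rb (R : realFieldType) (s x y : R) : 1 / 2 <= s <= 1 ->
  1 - s <= x <= 1 -> 0 <= y <= s ->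
  let g := duality_gap (shift_cost s) (T_shift s) (phi_shift s) x y in
  0 <= g /\ (g = 0 -> [\/ x = T_shift s y, x = 1 - s | y = s]).
Proof.
move=> hs hx hy g; have ys : y <= s by lra.
have E : g = (x - (1 - s) - y) ^+ 2 *
    (3 * ((2 * s - 1) * (x - (1 - s))) + 6 * ((1 - s) * (s - y))).
  rewrite /g /duality_gap /T_shift ys !phi_shiftR; [|lra|lra].
  by rewrite /shift_cost /cubic_cost; ring.
have h1 : 0 <= (2 * s - 1) * (x - (1 - s)) by apply: mulr_ge0; lra.
have h2 : 0 <= (1 - s) * (s - y) by apply: mulr_ge0; lra.
rewrite E; split; first by apply: mulr_ge0; [exact: sqr_ge0|lra].
move/eqP; rewrite mulf_eq0 expf_eq0/= => /orP[/eqP h|/eqP h].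
  by constructor 1; rewrite /T_shift ys; lra.
(* At [s = 1 / 2] the first product of the cofactor is identically zero and the second forces
   [y = s]; otherwise the first forces [x = 1 - s]. *)
have [s12|s12] := eqVneq (2 * s - 1) 0.
  constructor 3; have/eqP : (1 - s) * (s - y) = 0 by lra.
  by rewrite mulf_eq0 => /orP[] /eqP; lra.
constructor 2; have/eqP : (2 * s - 1) * (x - (1 - s)) = 0 by lra.
by rewrite mulf_eq0 (negbTE s12)/= => /eqP; lra.
Qed.

(** The lines [x = 1 - s] and [y = s] cut the square into four. The gap has a square factor in the
    corner already treated and in the opposite one; the other two are reached from the treated
    corner by integrating a partial derivative of the gap. *)
Lemma T_shift_optimal (R : realFieldType) (s : R) : 1 / 2 <= s <= 1 ->
  optimality_certificate (shift_cost s) (T_shift s) (phi_shift s) (1 - s) s.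
Proof.
move=> hs x y hx hy; set g := duality_gap _ _ _ x y.
have [ys|ys] := leP y s; have [xd|xd] := leP (1 - s) x.
- by apply: shift_gap_rb => //; lra.
(* Up to the factor [-3], the derivative of the gap in [x] is the product of [y - (1 - x)] and [2 *
   (2 * s) * x - (3 - 2 * s) * (1 - x + y)], whose values at [x] and at [1 - s] are bounded here. *)
- have [//||G _] := @shift_gap_rb _ s (1 - s) y hs; [lra|lra|].
  have p0 : y - (1 - x) < 0 by lra.
  have p1 : y - s <= 0 by lra.
  have q0 : 2 * (2 * s) * x - (3 - 2 * s) * (1 - x + y) < 0.
    have : s * x < s * (1 - s) by rewrite ltr_pM2l//; lra.
    have : 0 <= (3 - 2 * s) * (x + y - x) by apply: mulr_ge0; lra.
    have : 0 <= s * (2 * s - 1) by apply: mulr_ge0; lra.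
    have : 0 <= (3 - 2 * s) * (1 - s - x) by apply: mulr_ge0; lra.
    lra.
  have q1 : 2 * (2 * s) * (1 - s) - (3 - 2 * s) * (s + y) <= 0.
    have : 0 <= s * (2 * s - 1) by apply: mulr_ge0; lra.
    have : 0 <= (3 - 2 * s) * y by apply: mulr_ge0; lra.
    lra.
  have P := affine_prod_gt0 p0 p1 q0 q1.
  have : 0 < (1 - s - x) / 2 * affine_prod (y - (1 - x)) (y - s)
      (2 * (2 * s) * x - (3 - 2 * s) * (1 - x + y))
      (2 * (2 * s) * (1 - s) - (3 - 2 * s) * (s + y)).
    by apply: mulr_gt0 => //; lra.
  suff <- : g - duality_gap (shift_cost s) (T_shift s) (phi_shift s) (1 - s) y =
    (1 - s - x) / 2 * affine_prod (y - (1 - x)) (y - s)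
      (2 * (2 * s) * x - (3 - 2 * s) * (1 - x + y))
      (2 * (2 * s) * (1 - s) - (3 - 2 * s) * (s + y)).
    by move=> g0; split; lra.
  rewrite /g /duality_gap (phi_shiftR (lexx (1 - s))).
  by rewrite /phi_shift (ltW xd) /shift_cost /cubic_cost /affine_prod; field.
- have [//||G _] := @shift_gap_rb _ s x s hs; [lra|lra|].
  have p1 : 1 - s - x <= 0 by lra.
  have p0 : 1 - y - x < 0 by lra.
  have q1 : 2 * s * (1 - s + x) - 2 * (3 - 2 * s) * s <= 0.
    have : 0 <= s * (1 - x) by apply: mulr_ge0; lra.
    have : 0 <= s * (1 - s) by apply: mulr_ge0; lra.
    lra.
  have q0 : 2 * s * (1 - y + x) - 2 * (3 - 2 * s) * y < 0.
    have : 0 < (y - s) * (6 - 2 * s) by apply: mulr_gt0; lra.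
    lra.
  have P := affine_prod_gt0 p0 p1 q0 q1.
  have : 0 < (y - s) / 2 * affine_prod (1 - y - x) (1 - s - x)
      (2 * s * (1 - y + x) - 2 * (3 - 2 * s) * y)
      (2 * s * (1 - s + x) - 2 * (3 - 2 * s) * s).
    by apply: mulr_gt0 => //; lra.
  suff <- : g - duality_gap (shift_cost s) (T_shift s) (phi_shift s) x s =
    (y - s) / 2 * affine_prod (1 - y - x) (1 - s - x)
      (2 * s * (1 - y + x) - 2 * (3 - 2 * s) * y)
      (2 * s * (1 - s + x) - 2 * (3 - 2 * s) * s).
    by move=> g0; split; lra.
  (* [T_shift s] jumps from [1] to [1 - s] at [y = s], but the potential in [y] is continuous there
     by the choice of the multipliers, so no jump adds to the integral from [s] to [y]. *)
  rewrite /g /duality_gap (phi_shiftR xd) /T_shift lexx (lt_geF ys).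
  rewrite (@phi_shiftR _ s (s + _)); last lra.
  have -> : phi_shift s (1 - y) =
    2 * s * (3 * (1 - y) ^+ 2 - 2 * (1 - y) ^+ 3) + (3 - 2 * s) * (1 - (1 - y)) ^+ 3
    - (2 * s * (3 * (1 - s) ^+ 2 - 2 * (1 - s) ^+ 3) + (3 - 2 * s) * s ^+ 3).
    by rewrite /phi_shift; case: leP => //; lra.
  by rewrite /shift_cost /cubic_cost /affine_prod; field.
have E : g = (x + y - 1) ^+ 2 *
    (3 * ((3 - 2 * s) * y - 2 * s * (1 - y)) - (3 + 2 * s) * (x + y - 1)).
  rewrite /g /duality_gap /T_shift leNgt ys/= /phi_shift (ltW xd).
  have -> : 1 - y <= 1 - s by lra.
  by rewrite /shift_cost /cubic_cost; ring.
have M0 : 0 < 3 * ((3 - 2 * s) * y - 2 * s * (1 - y)) - (3 + 2 * s) * (x + y - 1).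
  have : 0 <= (3 + 2 * s) * (1 - s - x) by apply: mulr_ge0; lra.
  have : 0 <= (6 - 2 * s) * (y - s) by apply: mulr_ge0; lra.
  have : 0 < s * (3 - 2 * s) by apply: mulr_gt0; lra.
  lra.
rewrite E; split; first by rewrite mulr_ge0 ?sqr_ge0// ltW.
move/eqP; rewrite mulf_eq0 expf_eq0/= => /orP[/eqP h|/eqP h]; last by lra.
by constructor 1; rewrite /T_shift leNgt ys/=; lra.
Qed.

(** * The folded support *)

(** The map rises from [1 - b] to [1] on [[0, b / (2 * (1 - b))]], is back at [1 - b] when [y = b],
    and then follows the antidiagonal. The first test is cleared of its denominator. *)
Definition T_fold (R : realFieldType) (b y : R) :=
  if 2 * (1 - b) * y <= b then (1 - b) * (1 + 2 * y)
  else if y <= b then 1 - (2 * (1 - b) * y - b) / (1 - 2 * b) else 1 - y.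

(* The analogue of [phi_shift]; above [1 - b] the two branches of the support
   over the same [x] give the same derivative. *)
Definition phi_fold (R : realFieldType) (b x : R) : R :=
  if x <= 1 - b then
    2 * (1 - b) * (b * (3 * x ^+ 2 - 2 * x ^+ 3) + 2 * (1 - b) * (1 - x) ^+ 3)
    - 2 * (1 - b) * (b * (3 * (1 - b) ^+ 2 - 2 * (1 - b) ^+ 3) + 2 * (1 - b) * b ^+ 3)
  else 3 * b * (1 - b) * (x - (1 - b)) ^+ 2 - (1 - 2 * b) * (x - (1 - b)) ^+ 3.

Lemma phi_foldR (R : realFieldType) (b x : R) : 1 - b <= x ->
  phi_fold b x =
  3 * b * (1 - b) * (x - (1 - b)) ^+ 2 - (1 - 2 * b) * (x - (1 - b)) ^+ 3.
Proof.
move=> h2; rewrite /phi_fold; case: leP => // h1.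
have -> : x = 1 - b by lra.
by ring.
Qed.

(** The middle branch is given by an equation on its value [t], which keeps quotients out of the
    case analyses. *)
Variant T_fold_spec (R : realFieldType) (b y : R) : R -> Prop :=
| Tfold1 of 2 * (1 - b) * y <= b & y <= b : T_fold_spec b y ((1 - b) * (1 + 2 * y))
| Tfold2 t of b < 2 * (1 - b) * y & y <= b &
    (1 - 2 * b) * (1 - t) = 2 * (1 - b) * y - b : T_fold_spec b y t
| Tfold3 of b < y : T_fold_spec b y (1 - y).

Lemma T_foldP (R : realFieldType) (b y : R) : 0 <= b < 1 / 2 -> 0 <= y <= 1 ->
  T_fold_spec b y (T_fold b y).
Proof.
move=> hb hy; have h : 0 <= (1 - 2 * b) * y by apply: mulr_ge0; lra.
rewrite /T_fold; case: leP => h1; first by constructor => //; lra.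
case: leP => h2; last by constructor.
by constructor => //; field; lra.
Qed.

Lemma T_fold_superlevel (R : realFieldType) (b : R) : 0 <= b < 1 / 2 ->
  superlevel_intervals (T_fold b).
Proof.
move=> hb x hx; have [xd|xd] := leP x (1 - b).
  exists 0; split; [lra|lra|] => y hy; case: T_foldP => // [h1 h2|t h1 h2 ht|h1].
  - have h3 : 0 <= (1 - b) * y by apply: mulr_ge0; lra.
    have -> : x <= (1 - b) * (1 + 2 * y) by lra.
    by apply/esym/andP; split; lra.
  - have h3 : (1 - 2 * b) * (1 - t) <= (1 - 2 * b) * b.
      have : 0 <= (1 - b) * (b - y) by apply: mulr_ge0; lra.
      lra.
    rewrite ler_pM2l in h3; last lra.
    have -> : x <= t by lra.
    by apply/esym/andP; split; lra.
  - by apply/idP/andP => [h|[h3 h2]]; [split|]; lra.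
have d0 : 0 < 2 * (1 - b) by lra.
(* Above [1 - b] the superlevel set runs from the increasing branch to the decreasing one. Their
   inverse slopes have absolute values [1 / (2 * (1 - b))] and [(1 - 2 * b) / (2 * (1 - b))], of sum
   [1]; hence the length [1 - x]. *)
exists ((x - (1 - b)) / (2 * (1 - b))).
have E : (x - (1 - b)) / (2 * (1 - b)) + (1 - x) = (1 - b - (1 - 2 * b) * x) / (2 * (1 - b)).
  by field; lra.
have h0 : 0 <= (1 - 2 * b) * (1 - x) by apply: mulr_ge0; lra.
have h0' : 0 < (1 - 2 * b) * (x - (1 - b)) by apply: mulr_gt0; lra.
rewrite E; split.
- by apply: divr_ge0; lra.
- have : 0 <= (1 - 2 * b) * x by apply: mulr_ge0; lra.
  by rewrite ler_pdivrMr // mul1r; lra.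
move=> y hy; rewrite ler_pdivrMr// ler_pdivlMr//.
case: T_foldP => // [h1 h2|t h1 h2 ht|h1].
- apply/idP/andP => [h|[h3 h4]]; [split|]; lra.
- rewrite -(@ler_pM2l _ (1 - 2 * b)); last lra.
  apply/idP/andP => [h|[h3 h4]]; [split|]; lra.
- have h2 : 0 < (y - b) * (1 - b) by apply: mulr_gt0; lra.
  have h3 : 0 <= b * (1 - 2 * b) by apply: mulr_ge0; lra.
  apply/idP/andP => [h|[h5 h4]]; [split|]; lra.
Qed.

(** With the ratio [b / (2 * (1 - b))] of the multipliers, the line where the mixed derivative
    changes sign runs midway, in [y], between the two branches of the fold and meets [x = 1] at
    their common point. *)
Definition fold_cost (R : realFieldType) (b : R) :=
  cubic_cost (6 * b * (1 - b)) (12 * (1 - b) ^+ 2).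

(** For fixed [x] the derivative of the cost in [x] is quadratic in [y] and equals that of
    [phi_fold b] on both branches. The derivative of the gap is therefore a multiple of the product
    of the two branch equations; integrated from [T_fold b y], it gives a square times a nonnegative
    form. *)
Lemma fold_gap_rb (R : realFieldType) (b x y : R) : 0 <= b < 1 / 2 ->
  1 - b <= x <= 1 -> 0 <= y <= b ->
  let g := duality_gap (fold_cost b) (T_fold b) (phi_fold b) x y in
  0 <= g /\ (g = 0 -> [\/ x = T_fold b y, x = 1 | y = b / (2 * (1 - b))]).
Proof.
move=> hb hx hy g; rewrite {}/g /duality_gap.
have h0 : 0 <= (1 - 2 * b) * y by apply: mulr_ge0; lra.
have h0' : 0 <= (1 - 2 * b) * (1 - x) by apply: mulr_ge0; lra.
have d0 : 2 * (1 - b) != 0 by lra.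
have yk : 2 * (1 - b) * y = b -> y = b / (2 * (1 - b)).
  by move=> h; apply: (mulIf d0); rewrite divfK//; lra.
case: T_foldP => // [|h1 h2|t h1 h2 ht|h1]; [lra| | |lra].
- have h3 : 0 <= (1 - b) * y by apply: mulr_ge0; lra.
  rewrite !phi_foldR; [|lra|lra].
  set g := (X in 0 <= X).
  have E : g = (x - (1 - b) * (1 + 2 * y)) ^+ 2 / 2 *
      ((1 - b - (1 - 2 * b) * ((1 - b) * (1 + 2 * y)) - 2 * (1 - b) * y) +
       2 * (1 - b - (1 - 2 * b) * x - 2 * (1 - b) * y)).
    by rewrite /g /fold_cost /cubic_cost; field.
  have m1 : 0 <= (1 - 2 * b) * (b - 2 * (1 - b) * y) by apply: mulr_ge0; lra.
  rewrite -/g E; split.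
    by apply: mulr_ge0; [apply: divr_ge0 => //; exact: sqr_ge0|lra].
  move/eqP; rewrite mulf_eq0 mulf_eq0 expf_eq0/= invr_eq0 pnatr_eq0 orbF.
  move=> /orP[/eqP h|/eqP h]; first by constructor 1; lra.
  by constructor 3; apply: yk; lra.
- have h3 : (1 - 2 * b) * (1 - t) <= (1 - 2 * b) * b.
    have : 0 <= (1 - b) * (b - y) by apply: mulr_ge0; lra.
    lra.
  rewrite ler_pM2l in h3; last lra.
  have t1 : 0 <= 1 - t.
    by rewrite -(@pmulr_rge0 _ (1 - 2 * b)); lra.
  rewrite !phi_foldR; [|lra|lra].
  set g := (X in 0 <= X).
  have ey : y = (b + (1 - 2 * b) * (1 - t)) / (2 * (1 - b)).
    by rewrite ht addrC subrK [_ * y]mulrC mulfK//; lra.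
  have E : g = (1 - 2 * b) * ((x - t) ^+ 2 / 2) *
      ((2 * (1 - b) * y - (t - (1 - b))) + 2 * (2 * (1 - b) * y - (x - (1 - b)))).
    by rewrite /g /fold_cost /cubic_cost ey; field; lra.
  rewrite -/g E; split.
    apply: mulr_ge0; last lra.
    by apply: mulr_ge0; [lra|apply: divr_ge0 => //; exact: sqr_ge0].
  move/eqP; rewrite mulf_eq0 mulf_eq0 [_ / 2 == 0]mulf_eq0 expf_eq0/= invr_eq0 pnatr_eq0 orbF.
  by move=> /orP[/orP[/eqP h|/eqP h]|/eqP h]; [|constructor 1|]; lra.
Qed.

(** Same division into four as for the shift, now along [x = 1 - b] and [y = b]: square factors in
    two opposite corners, integrals of products of negative affine functions in the other two. *)
Lemma T_fold_optimal (R : realFieldType) (b : R) : 0 <= b < 1 / 2 ->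
  optimality_certificate (fold_cost b) (T_fold b) (phi_fold b) 1 (b / (2 * (1 - b))).
Proof.
move=> hb x y hx hy; set g := duality_gap _ _ _ x y.
have [yb|yb] := leP y b; have [xd|xd] := leP (1 - b) x.
- by apply: fold_gap_rb => //; lra.
- have [//||G _] := @fold_gap_rb _ b (1 - b) y hb; [lra|lra|].
  have p0 : y - (1 - x) < 0 by lra.
  have p1 : y - b <= 0 by lra.
  have q0 : 2 * b * x - 2 * (1 - b) * (1 - x + y) < 0.
    have : 0 <= (1 - b) * y by apply: mulr_ge0; lra.
    lra.
  have q1 : 2 * b * (1 - b) - 2 * (1 - b) * (b + y) <= 0.
    have : 0 <= (1 - b) * y by apply: mulr_ge0; lra.
    lra.
  have P := affine_prod_gt0 p0 p1 q0 q1.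
  set A := affine_prod _ _ _ _ in P.
  have : 0 < (1 - b - x) * (1 - b) * A.
    by rewrite !mulr_gt0//; lra.
  suff <- : g - duality_gap (fold_cost b) (T_fold b) (phi_fold b) (1 - b) y =
    (1 - b - x) * (1 - b) * A.
    by move=> g0; split; lra.
  rewrite /g /duality_gap (phi_foldR (lexx (1 - b))).
  by rewrite {1}/phi_fold (ltW xd) /fold_cost /cubic_cost /A /affine_prod; field.
- have [//||G _] := @fold_gap_rb _ b x b hb; [lra|lra|].
  have p1 : 1 - b - x <= 0 by lra.
  have p0 : 1 - y - x < 0 by lra.
  have q1 : b * (1 - b + x) - 4 * (1 - b) * b <= 0.
    have : 0 <= b * (1 - x) by apply: mulr_ge0; lra.
    have : 0 <= b * (2 - 3 * b) by apply: mulr_ge0; lra.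
    lra.
  have q0 : b * (1 - y + x) - 4 * (1 - b) * y < 0.
    have : 0 < (y - b) * (4 - 3 * b) by apply: mulr_gt0; lra.
    lra.
  have P := affine_prod_gt0 p0 p1 q0 q1.
  set A := affine_prod _ _ _ _ in P.
  have : 0 < (y - b) * (1 - b) * A.
    by rewrite !mulr_gt0//; lra.
  suff <- : g - duality_gap (fold_cost b) (T_fold b) (phi_fold b) x b =
    (y - b) * (1 - b) * A.
    by move=> g0; split; lra.
  have Tb : T_fold b b = 1 - b.
    have h : 0 <= b * (1 - 2 * b) by apply: mulr_ge0; lra.
    rewrite /T_fold lexx; case: leP => h'; last by field; lra.
    (* The first branch applies at [y = b] only if [b = 0], and there it also gives [1 - b]. *)
    have /eqP : b * (1 - 2 * b) = 0 by lra.
    by rewrite mulf_eq0 => /orP[/eqP ->|/eqP]; [ring|lra].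
  have Ty : T_fold b y = 1 - y.
    by case: T_foldP => // *; lra.
  rewrite /g /duality_gap Tb Ty (phi_foldR xd) (phi_foldR (lexx (1 - b))).
  have -> : phi_fold b (1 - y) =
    2 * (1 - b) * (b * (3 * (1 - y) ^+ 2 - 2 * (1 - y) ^+ 3) + 2 * (1 - b) * (1 - (1 - y)) ^+ 3)
    - 2 * (1 - b) * (b * (3 * (1 - b) ^+ 2 - 2 * (1 - b) ^+ 3) + 2 * (1 - b) * b ^+ 3).
    by rewrite /phi_fold; case: leP => //; lra.
  by rewrite /fold_cost /cubic_cost /A /affine_prod; field.
have Ty : T_fold b y = 1 - y.
  by case: T_foldP => // *; lra.
have E : g = 2 * (1 - b) * (x + y - 1) ^+ 2 *
    (3 * (2 * (1 - b) * y - b * (1 - y)) - 2 * (x + y - 1)).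
  rewrite /g /duality_gap Ty /phi_fold (ltW xd).
  have -> : 1 - y <= 1 - b by lra.
  by rewrite /fold_cost /cubic_cost; ring.
have M0 : 0 < 3 * (2 * (1 - b) * y - b * (1 - y)) - 2 * (x + y - 1).
  have : 0 < (4 - 3 * b) * (y - b) by apply: mulr_gt0; lra.
  have : 0 <= b * (1 - b) by apply: mulr_ge0; lra.
  lra.
rewrite E; split.
  by apply: mulr_ge0 (ltW M0); apply: mulr_ge0 (sqr_ge0 _); lra.
move/eqP; rewrite mulf_eq0 mulf_eq0 expf_eq0/=.
move=> /orP[/orP[/eqP h|/eqP h]|/eqP h]; [lra| |lra].
by constructor 1; rewrite Ty; lra.
Qed.

(** * Integral formula for Blest's coefficient *)

(** Clamping [1 - u] to the unit interval makes the moments integrals of bounded functions on the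
    whole plane, whatever the probability. *)
Definition flip (R : realType) (u : R) : R := Num.max 0 (Num.min 1 (1 - u)).

Variant flip_spec (R : realType) (u : R) : R -> Prop :=
| Flip_le0 of u < 0 : flip_spec u 1
| Flip_in of 0 <= u <= 1 : flip_spec u (1 - u)
| Flip_ge1 of 1 < u : flip_spec u 0.

Lemma flipP (R : realType) (u : R) : flip_spec u (flip u).
Proof.
rewrite /flip; have [u0|u0] := ltP u 0.
  by rewrite min_l ?max_r//; [constructor|lra].
rewrite min_r; last lra.
have [u1|u1] := leP u 1; first by rewrite max_r; [constructor|]; lra.
by rewrite max_l; [constructor|lra].
Qed.

Lemma flip01 (R : realType) (u : R) : 0 <= flip u <= 1.
Proof. by case: flipP; lra. Qed.

Lemma flipE (R : realType) (u : R) : 0 <= u <= 1 -> flip u = 1 - u.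
Proof. by case: flipP; lra. Qed.

Lemma measurable_flip (R : realType) : measurable_fun setT (@flip R).
Proof.
by apply: measurable_maxr => //; apply: measurable_minr => //; exact: measurable_funB.
Qed.

Lemma integral_polynomial (R : realType) (p : {poly R}) (a b : R) : a <= b ->
  \int[@lebesgue_measure R]_(x in `[a, b]) p^`().[x] = p.[b] - p.[a].
Proof.
rewrite le_eqVlt => /orP[/eqP <-|ab].
  by rewrite set_itv1 Rintegral_set1 subrr.
rewrite /Rintegral (@continuous_FTC2 _ (horner p^`()) (horner p))//.
- by apply: continuous_subspaceT; exact: continuous_horner.
- split.
  + by move=> x _; exact: derivable_horner.
  + exact/cvg_at_right_filter/continuous_horner.
  + exact/cvg_at_left_filter/continuous_horner.
- by move=> x _; rewrite derivE.
Qed.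

Lemma integral_cubic (R : realType) (c0 c1 c2 c3 a b : R) : a <= b ->
  \int[@lebesgue_measure R]_(x in `[a, b])
     (c0 + c1 * x + c2 * x ^+ 2 + c3 * x ^+ 3) =
  c0 * (b - a) + c1 / 2 * (b ^+ 2 - a ^+ 2) + c2 / 3 * (b ^+ 3 - a ^+ 3) +
  c3 / 4 * (b ^+ 4 - a ^+ 4).
Proof.
move=> ab.
pose p : {poly R} := c0 *: 'X + (c1 / 2) *: 'X^2 + (c2 / 3) *: 'X^3 + (c3 / 4) *: 'X^4.
transitivity (\int[@lebesgue_measure R]_(x in `[a, b]) p^`().[x]).
  apply: eq_Rintegral => x _.
  by rewrite /p !poly.derivE !hornerE /=; field.
by rewrite integral_polynomial// /p !hornerE /=; field.
Qed.

Lemma integral_tail (R : realType) (f : R -> R) (z : R) : measurable_fun setT f ->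
  (\int[@lebesgue_measure R]_t
     (if z <= t then if 0 <= t <= 1 then f t else 0 else 0)%:E =
   \int[@lebesgue_measure R]_(t in `[(1 - flip z)%R, 1%R]) (f t)%:E)%E.
Proof.
move=> mf; have [z1|z1] := leP z 1.
  rewrite [RHS]integral_mkcond; apply: eq_integral => t _.
  rewrite patchE mem_setE /= in_itv /=.
  have -> : (1 - flip z <= t <= 1) = (z <= t) && (0 <= t <= 1).
    by case: flipP => ?; apply/idP/idP => [/andP[? ?]|/andP[? /andP[? ?]]];
      repeat (apply/andP; split); lra.
  by case: (z <= t); case: (0 <= t <= 1).
(* For [z > 1] the left integrand is zero, while the segment on the right is the null set reduced to
   [1]. *)
have -> : flip z = 0 by case: flipP => //; lra.
rewrite subr0 set_itv1 integral_set1 -[RHS](@integral0 _ _ _ (@lebesgue_measure R) setT).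
apply: eq_integral => t _; case: ifP => // zt; case: ifP => // t1; exfalso; lra.
Qed.

(** Integrating first over the threshold [t] removes one variable of the distribution function. It
    serves once per coordinate, [k] carrying the factor that does not depend on [t]. *)
Lemma tail_tonelli d (T : measurableType d) (R : realType) (P : probability T R)
    (Z : T -> R) (k : T -> R) (h : R -> R) :
  measurable_fun setT Z -> measurable_fun setT k -> measurable_fun setT h ->
  (forall w, 0 <= k w) -> (forall t, 0 <= h t) ->
  (\int[@lebesgue_measure R]_t \int[P]_w (if (Z w <= t)%R then h t * k w else 0)%:E =
   \int[P]_w ((k w)%:E * \int[@lebesgue_measure R]_t (if (Z w <= t)%R then h t else 0)%:E))%E.
Proof.
move=> mZ mk mh k0 h0.
pose f (p : measurableTypeR R * T) := (if (Z p.2 <= p.1)%R then h p.1 * k p.2 else 0)%:E.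
have mf : measurable_fun setT f.
  apply/measurable_EFinP; apply: measurable_fun_ifT => //.
    apply: measurable_fun_ler => //; first exact: measurableT_comp.
  by apply: measurable_funM; apply: measurableT_comp.
have f0 p : (0 <= f p)%E by rewrite lee_fin; case: ifP => // _; rewrite mulr_ge0.
rewrite (@fubini_tonelli _ _ _ _ _ (@lebesgue_measure R) P f)//.
apply: eq_integral => w _; rewrite -ge0_integralZl//; last 3 first.
- apply/measurable_EFinP; apply: measurable_fun_ifT => //.
  exact: measurable_fun_ler.
- by move=> t _; rewrite lee_fin; case: ifP.
- by rewrite lee_fin.
by apply: eq_integral => t _; rewrite /f /=; case: ifP => _; rewrite -EFinM ?mulr0// mulrC.
Qed.

Definition moment (R : realType) (i j : nat)
    (P : probability (measurableTypeR R * measurableTypeR R)%type R) : R :=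
  \int[P]_w (flip w.1 ^+ i * flip w.2 ^+ j).

Lemma integral_tail1 (R : realType) (z : R) :
  (\int[@lebesgue_measure R]_t
     (if z <= t then if 0 <= t <= 1 then 1 else 0 else 0)%:E = (flip z)%:E)%E.
Proof.
have /andP[f0 f1] := flip01 z.
rewrite (@integral_tail _ (fun=> 1))// integral_cst//= lebesgue_measure_itv/=.
rewrite mul1e lte_fin; case: ifPn => h; first by rewrite -EFinD; congr EFin; lra.
by congr EFin; lra.
Qed.

Lemma integral_tail_id (R : realType) (z : R) :
  (\int[@lebesgue_measure R]_t
     (if z <= t then if 0 <= t <= 1 then 1 - t else 0 else 0)%:E
   = (flip z ^+ 2 / 2)%:E)%E.
Proof.
have /andP[f0 f1] := flip01 z.
rewrite (@integral_tail _ (fun t => 1 - t)); last exact: measurable_funB.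
have h : 1 - flip z <= 1 by lra.
have := integral_cubic 1 (-1) 0 0 h; rewrite /Rintegral => E.
rewrite -[LHS]fineK.
  congr EFin; transitivity (fine (\int[@lebesgue_measure R]_(x in `[(1 - flip z)%R, 1%R])
    (1 + (-1) * x + 0 * x ^+ 2 + 0 * x ^+ 3)%:E)).
    by congr fine; apply: eq_integral => x _; congr EFin; rewrite !mul0r !addr0 mulN1r.
  by rewrite E; field.
apply: integrable_fin_num => //.
apply: continuous_compact_integrable; first exact: segment_compact.
apply: continuous_subspaceT => x; apply: continuousB; [exact: cvg_cst|exact: cvg_id].
Qed.

Lemma measurable_flip1 (R : realType) :
  measurable_fun setT (fun w : measurableTypeR R * measurableTypeR R => flip w.1).
Proof. exact: measurableT_comp (@measurable_flip R) measurable_fst. Qed.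

Lemma measurable_flip2 (R : realType) :
  measurable_fun setT (fun w : measurableTypeR R * measurableTypeR R => flip w.2).
Proof. exact: measurableT_comp (@measurable_flip R) measurable_snd. Qed.

Lemma probability_bounded_integrable d (T : measurableType d) (R : realType)
    (P : probability T R) (f : T -> R) (M : R) :
  measurable_fun setT f -> (forall x, `|f x| <= M) ->
  P.-integrable setT (EFin \o f).
Proof.
move=> mf fM; apply: measurable_bounded_integrable => //.
  exact: le_lt_trans (probability_le1 P measurableT) (ltry 1).
exists M; split; first exact: num_real.
by move=> N MN x _; exact: le_trans (fM x) (ltW MN).
Qed.

Lemma normr_moment_le1 (R : realType) (i j : nat) (w : R * R) :
  `|flip w.1 ^+ i * flip w.2 ^+ j| <= 1.
Proof.
have /andP[f0 f1] := flip01 w.1; have /andP[g0 g1] := flip01 w.2.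
by rewrite ger0_norm ?mulr_ge0 ?exprn_ge0// mulr_ile1 ?exprn_ge0 ?exprn_ile1.
Qed.

Lemma measurable_moment (R : realType) (i j : nat) : measurable_fun setT
  (fun w : measurableTypeR R * measurableTypeR R => flip w.1 ^+ i * flip w.2 ^+ j).
Proof.
by apply: measurable_funM; apply: measurable_funX;
  [exact: measurable_flip1|exact: measurable_flip2].
Qed.

Lemma moment_integrable (R : realType) (i j : nat)
    (P : probability (measurableTypeR R * measurableTypeR R)%type R) :
  P.-integrable setT (EFin \o (fun w => flip w.1 ^+ i * flip w.2 ^+ j)).
Proof.
exact: probability_bounded_integrable (@measurable_moment R i j) (@normr_moment_le1 R i j).
Qed.

(** The integral of [1 - u] over [u] from [U] to [1] is [(1 - U) ^+ 2 / 2], and that of [1] over [v]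
    from [V] to [1] is [1 - V]. By Tonelli the double integral is half a moment, whence the factor
    [12]. *)
Lemma blest_joint_cdf (R : realType)
    (P : probability (measurableTypeR R * measurableTypeR R)%type R) :
  blest (joint_cdf P) = 12 * moment 2 1 P - 2.
Proof.
have mfst : measurable_fun setT (fst : measurableTypeR R * measurableTypeR R -> measurableTypeR R).
  exact: measurable_fst.
have msnd : measurable_fun setT (snd : measurableTypeR R * measurableTypeR R -> measurableTypeR R).
  exact: measurable_snd.
have m01 (f : R -> R) : measurable_fun setT f ->
    measurable_fun setT (fun t : R => if 0 <= t <= 1 then f t else 0).
  move=> mf; apply: measurable_fun_ifT => //.
  by apply: measurable_and; exact: measurable_fun_ler.
pose H (w : measurableTypeR R * measurableTypeR R) := flip w.1 ^+ 2 / 2.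
have mH : measurable_fun setT H.
  by apply: measurable_funM => //; apply: measurable_funX; exact: measurable_flip1.
have H0 w : 0 <= H w by rewrite divr_ge0// sqr_ge0.
have inner v : (\int[@lebesgue_measure R]_(u in `[0%R, 1%R]) ((1 - u) * joint_cdf P u v)%:E =
    \int[P]_w (if (w.2 <= v)%R then H w else 0)%:E)%E.
  transitivity (\int[@lebesgue_measure R]_u \int[P]_w (if (w.1 <= u)%R then
      (if (0 <= u <= 1)%R then 1 - u else 0) * (if (w.2 <= v)%R then 1 else 0) else 0)%:E)%E.
    rewrite integral_mkcond; apply: eq_integral => u _; rewrite patchE mem_setE /= in_itv /=.
    case: ifP => [u01|u01]; last first.
      by rewrite integral0_eq// => w _; case: ifP => // _; rewrite mul0r.
    rewrite EFinM /joint_cdf fineK ?fin_num_measure//; last exact: measurableX.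
    transitivity (\int[P]_w ((1 - u)%:E * (\1_(`]-oo, u] `*` `]-oo, v]) w)%:E))%E.
      rewrite ge0_integralZl//=; first by rewrite integral_indic ?setIT//; exact: measurableX.
        by apply/measurable_EFinP; apply: measurable_indic; exact: measurableX.
      by rewrite lee_fin; lra.
    apply: eq_integral => w _; rewrite -EFinM indicE; congr EFin.
    case: (leP w.1 u) => h1; case: (leP w.2 v) => h2.
    - by rewrite mem_set//=; split; rewrite /= in_itv.
    - by rewrite memNset//= => -[_]; rewrite /= in_itv/= leNgt h2.
    - by rewrite memNset ?mulr0//= => -[]; rewrite /= in_itv/= leNgt h1.
    - by rewrite memNset ?mulr0//= => -[]; rewrite /= in_itv/= leNgt h1.
  rewrite (@tail_tonelli _ _ _ P fst (fun w => if w.2 <= v then 1 else 0)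
    (fun u => if 0 <= u <= 1 then 1 - u else 0))//.
  - apply: eq_integral => w _; rewrite integral_tail_id.
    by case: ifP => _; rewrite ?mul1e ?mul0e.
  - by apply: measurable_fun_ifT => //; exact: measurable_fun_ler.
  - by apply: m01; exact: measurable_funB.
  - by move=> w; case: ifP.
  - by move=> t; case: ifP => // h; lra.
rewrite /blest; have -> : 24 * (\int[@lebesgue_measure R]_(v in `[0, 1])
   \int[@lebesgue_measure R]_(u in `[0, 1]) ((1 - u) * joint_cdf P u v)) = 24 * (moment 2 1 P / 2);
  last by lra.
congr (_ * _).
(* Finiteness allows the nested real integral to be read as an iterated extended one. *)
have fin v : (\int[P]_w (if (w.2 <= v)%R then H w else 0)%:E)%E \is a fin_num.
  rewrite ge0_fin_numE; last by apply: integral_ge0 => w _; rewrite lee_fin; case: ifP.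
  apply: (@le_lt_trans _ _ (\int[P]_w 1%E)%E).
    apply: ge0_le_integral => //=.
    + by move=> w _; rewrite lee_fin; case: ifP.
    + apply/measurable_EFinP; apply: measurable_fun_ifT => //.
      exact: measurable_fun_ler.
    + move=> w _; rewrite lee_fin; case: ifP => // _; rewrite /H.
      have /andP[f0 f1] := flip01 w.1.
      have : flip w.1 ^+ 2 <= 1 by rewrite expr_le1.
      by lra.
  by rewrite integral_cst//= mul1e probability_setT ltry.
rewrite /Rintegral.
transitivity (fine (\int[@lebesgue_measure R]_v \int[P]_w (if (w.2 <= v)%R then
   (if (0 <= v <= 1)%R then 1 else 0) * H w else 0)%:E)%E).
  congr fine; rewrite integral_mkcond; apply: eq_integral => v _.
  rewrite patchE mem_setE /= in_itv /=; case: ifP => [v01|v01]; last first.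
    by rewrite integral0_eq// => w _; case: ifP => // _; rewrite mul0r.
  rewrite inner fineK//; apply: eq_integral => w _; by rewrite mul1r.
rewrite (@tail_tonelli _ _ _ P snd H (fun u => if 0 <= u <= 1 then 1 else 0))//.
- rewrite /moment -RintegralZr//.
    rewrite /Rintegral; congr fine; apply: eq_integral => w _; rewrite integral_tail1 -EFinM.
    by congr EFin; rewrite /H expr1; ring.
  exact: (moment_integrable 2 1 P).
- exact: m01.
- by move=> t; case: ifP.
Qed.

(** * Copulas *)

Definition law d d' (T : measurableType d) (T' : measurableType d') (R : realType)
    (P : probability T R) (f : T -> T') (mf : measurable_fun setT f) :
    probability T' R :=
  distribution P (mfun_Sub (mem_set mf : f \in mfun)).

Lemma lawE d d' (T : measurableType d) (T' : measurableType d') (R : realType)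
    (P : probability T R) (f : T -> T') (mf : measurable_fun setT f) (A : set T') :
  law P mf A = P (f @^-1` A).
Proof. by []. Qed.

Lemma integral_law d d' (T : measurableType d) (T' : measurableType d') (R : realType)
    (P : probability T R) (f : T -> T') (mf : measurable_fun setT f)
    (g : T' -> R) (M : R) :
  measurable_fun setT g -> (forall x, `|g x| <= M) ->
  \int[law P mf]_x g x = \int[P]_x g (f x).
Proof.
move=> mg gM; rewrite /Rintegral /law integral_distribution//.
  exact/measurable_EFinP.
apply: (@probability_bounded_integrable _ _ _ P (g \o f) M) => //.
  exact: measurableT_comp.
by move=> x; exact: gM.
Qed.

Definition uniform01 (R : realType) : probability (measurableTypeR R) R :=
  uniform_prob (@ltr01 R).

Lemma integral_uniform01 (R : realType) (f : R -> \bar R) :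
  measurable_fun setT f -> (forall x, 0 <= f x)%E ->
  (\int[uniform01 R]_x f x = \int[@lebesgue_measure R]_(x in `[0%R, 1%R]) f x)%E.
Proof.
by move=> mf f0; rewrite /uniform01 integral_uniform// subr0 invr1 mul1e.
Qed.

Lemma uniform01E (R : realType) (A : set (measurableTypeR R)) : measurable A ->
  uniform01 R A = @lebesgue_measure R (A `&` `[0, 1]).
Proof.
move=> mA; have := @integral_uniform01 R (EFin \o \1_A).
rewrite !integral_indic// setIT => -> //; first exact/measurable_EFinP/measurable_indic.
by move=> x; rewrite lee_fin.
Qed.

Lemma lebesgue_segment (R : realType) (a b : R) : a <= b ->
  @lebesgue_measure R `[a, b] = (b - a)%:E.
Proof.
move=> ab; rewrite lebesgue_measure_itv/= lte_fin; case: ltP => [_|ba].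
  by rewrite EFinB.
by congr EFin; apply/esym/eqP; rewrite subr_eq0 eq_le ab ba.
Qed.

Lemma uniform01_superlevel (R : realType) (h : R -> R) (u : R) :
  measurable_fun setT h -> superlevel_intervals h ->
  uniform01 R [set y | 1 - h y <= u] = (1 - flip u)%:E.
Proof.
move=> mh hh; rewrite uniform01E; last first.
  rewrite -[X in measurable X]setTI; apply: (measurable_fun_ler _ _) => //.
  exact: measurable_funB.
have seg x p : 0 <= p -> p + (1 - x) <= 1 ->
    (forall y : R, 0 <= y <= 1 -> (x <= h y) = (p <= y <= p + (1 - x))) ->
    [set y | 1 - h y <= 1 - x] `&` `[0, 1] = `[p, p + (1 - x)]%classic.
  move=> p0 p1 hp; apply/seteqP; split => y /=; rewrite !in_itv/=.
    by move=> [h1 h2]; rewrite -hp//; lra.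
  move=> h1; have h2 : 0 <= y <= 1 by lra.
  have h3 : x <= h y by rewrite hp.
  by split => //; lra.
case: flipP => u01.
(* For [u < 0] the set lies within the superlevel set at level [1], an interval of length zero. *)
- have [|p [p0 p1 hp]] := hh 1; first by rewrite ler01 lexx.
  rewrite subrr; apply: (@subset_measure0 _ _ _ (@lebesgue_measure R)
    _ `[p, p + (1 - 1)]%classic) => //.
  + apply: measurableI => //; rewrite -[X in measurable X]setTI.
    by apply: (measurable_fun_ler _ _) => //; exact: measurable_funB.
  + by rewrite -(seg 1 p)// => y [/= h1 h2]; split => //=; lra.
  + transitivity ((p + (1 - 1) - p)%:E); last by congr EFin; ring.
    by apply: lebesgue_segment; lra.
- have [|p [p0 p1 hp]] := hh (1 - u); first lra.
  rewrite -[in LHS](subKr 1 u) (seg (1 - u) p)// lebesgue_segment; last lra.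
  by congr EFin; ring.
- have [|p [p0 p1 hp]] := hh 0; first by rewrite ler01 lexx.
  have -> : [set y | 1 - h y <= u] `&` `[0, 1] = `[0, 1]%classic.
    apply/seteqP; split => y /=; first by case.
    move=> y01; split => //; move: (y01); rewrite in_itv/= => y01'.
    have : 0 <= h y by rewrite hp//; lra.
    lra.
  by rewrite lebesgue_segment// ; congr EFin; ring.
Qed.

(** Open right half-lines are stable under intersection and generate the Borel sets, so agreement on
    them suffices. The uniform law itself is the case of the map [1 - y], and a single computation
    covers both sides. *)
Lemma uniform01_preserved (R : realType) (h : R -> R)
    (A : set (measurableTypeR R)) :
  measurable_fun setT h -> superlevel_intervals h -> measurable A ->
  uniform01 R ((fun y => 1 - h y) @^-1` A) = uniform01 R A.
Proof.
move=> mh hh mA.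
have mh' : measurable_fun setT (fun y : measurableTypeR R => 1 - h y : measurableTypeR R).
  exact: measurable_funB.
have mid : measurable_fun setT (fun y : measurableTypeR R => 1 - (1 - y) : measurableTypeR R).
  by apply: measurable_funB => //; exact: measurable_funB.
have hid : superlevel_intervals (fun y : R => 1 - y).
  move=> x x01; exists 0; split; [lra|lra|] => y y01.
  by apply/idP/idP; lra.
rewrite -(lawE _ mh').
rewrite -[RHS](_ : law (uniform01 R) mid A = _); last first.
  by rewrite lawE; congr (_ _); apply/seteqP; split => y /=; rewrite subKr.
apply: (@measure_unique _ R (measurableTypeR R) (@RGenOInfty.G R)
  (fun n => `]-n%:R, +oo[%classic) _ _ _ _ (law (uniform01 R) mh')
  (law (uniform01 R) mid)) => //.
- exact: RGenOInfty.measurableE.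
- move=> _ _ [x ->] [y ->]; exists (Num.max x y).
  by apply/seteqP; split => z /=; rewrite !in_itv/= !andbT gt_max => /andP.
- by move=> n; eexists.
- apply/seteqP; split => // x _; exists (Num.truncn (- x)).+1 => //=.
  by rewrite in_itv/= andbT ltrNl truncnS_gt.
- move=> _ [x ->].
  have E (k : R -> R) : measurable_fun setT k -> superlevel_intervals k ->
      uniform01 R ((fun y => 1 - k y) @^-1` `]x, +oo[) = (flip x)%:E.
    move=> mk hk; have -> : (fun y => 1 - k y) @^-1` `]x, +oo[ = ~` [set y | 1 - k y <= x].
      by apply/seteqP; split => y /=; rewrite in_itv/= andbT ltNge => /negP.
    rewrite probability_setC ?uniform01_superlevel//.
      by rewrite -EFinB; congr EFin; ring.
    rewrite -[X in measurable X]setTI; apply: (measurable_fun_ler _ _) => //.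
    exact: measurable_funB.
  apply: etrans (E _ mh hh) (esym (E _ _ hid)); exact: measurable_funB.
- by move=> n; rewrite (le_lt_trans (probability_le1 _ _)) ?ltry.
Qed.

Lemma uniform01_itv01 (R : realType) : uniform01 R `[0, 1]%classic = 1%E.
Proof. by rewrite uniform01E// setIid lebesgue_segment// subr0. Qed.

(** The complement of the square is a union of two sets, each null by one of the marginals. *)
Lemma uniform_marginals_square (R : realType)
    (P : probability (measurableTypeR R * measurableTypeR R)%type R) :
  uniform_marginals P -> P (`[0, 1] `*` `[0, 1]) = 1%E.
Proof.
move=> uP; have mI : measurable (`[0, 1]%classic : set (measurableTypeR R)) by [].
have U0 : uniform01 R (~` `[0, 1]) = 0%E.
  by rewrite probability_setC// uniform01_itv01 subee.
have [/= h1 h2] := uP _ (measurableC mI).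
have m1 : measurable (fst @^-1` (~` `[0, 1]) : set (measurableTypeR R * measurableTypeR R)).
  by rewrite -[X in measurable X]setTI; apply: measurable_fst => //; exact: measurableC.
have m2 : measurable (snd @^-1` (~` `[0, 1]) : set (measurableTypeR R * measurableTypeR R)).
  by rewrite -[X in measurable X]setTI; apply: measurable_snd => //; exact: measurableC.
have -> : `[0, 1] `*` `[0, 1] = ~` (fst @^-1` (~` `[0, 1]) `|` snd @^-1` (~` `[0, 1]))
    :> set (measurableTypeR R * measurableTypeR R).
  by rewrite setCU; apply/seteqP; split => w /=; rewrite !notK.
rewrite probability_setC ?measureU0//.
- by rewrite [X in (1 - X)%E](_ : _ = 0%E) ?sube0//; exact: etrans h1 U0.
- exact: etrans h2 U0.
- exact: measurableU.
Qed.

Definition swap_pair (R : realType) (w : measurableTypeR R * measurableTypeR R) :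
  measurableTypeR R * measurableTypeR R := (w.2, w.1).

Lemma measurable_swap_pair (R : realType) : measurable_fun setT (@swap_pair R).
Proof. by apply: measurable_fun_pair; [exact: measurable_snd|exact: measurable_fst]. Qed.

Definition transpose_law (R : realType)
    (P : probability (measurableTypeR R * measurableTypeR R)%type R) :=
  law P (@measurable_swap_pair R).

Lemma transpose_joint_cdf (R : realType)
    (P : probability (measurableTypeR R * measurableTypeR R)%type R) :
  transpose (joint_cdf P) = joint_cdf (transpose_law P).
Proof.
apply/funext => u; apply/funext => v; rewrite /transpose /joint_cdf [X in _ = fine X]lawE.
by congr (fine (P _)); apply/seteqP; split => -[x y] /= [h1 h2]; split.
Qed.

Lemma uniform_marginals_transpose (R : realType)
    (P : probability (measurableTypeR R * measurableTypeR R)%type R) :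
  uniform_marginals P -> uniform_marginals (transpose_law P).
Proof. by move=> uP A mA; have [h1 h2] := uP A mA; split. Qed.

Lemma copula_joint_cdf (R : realType)
    (P : probability (measurableTypeR R * measurableTypeR R)%type R) :
  uniform_marginals P -> copula (joint_cdf P).
Proof. by move=> uP; exists P; split => //; exact: uniform_marginals_square. Qed.

Lemma copula_transpose (R : realType) (C : R -> R -> R) :
  copula C -> copula (transpose C).
Proof.
move=> [P [_ uP ->]]; rewrite transpose_joint_cdf.
exact/copula_joint_cdf/uniform_marginals_transpose.
Qed.

Lemma moment_transpose (R : realType) (i j : nat)
    (P : probability (measurableTypeR R * measurableTypeR R)%type R) :
  moment i j (transpose_law P) = moment j i P.
Proof.
rewrite /moment (@integral_law _ _ _ _ _ _ _ _ _ 1)//.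
- by apply: eq_Rintegral => w _; rewrite mulrC.
- exact: measurable_moment.
- exact: normr_moment_le1.
Qed.

Lemma blest_transpose_joint_cdf (R : realType)
    (P : probability (measurableTypeR R * measurableTypeR R)%type R) :
  blest (transpose (joint_cdf P)) = 12 * moment 1 2 P - 2.
Proof. by rewrite transpose_joint_cdf blest_joint_cdf moment_transpose. Qed.

(** * Mixtures of couplings *)

Section mixture.
Context d (T : measurableType d) (R : realType) (P Q : probability T R).
Context (t : R) (t01 : 0 <= t <= 1).

Let t0 : 0 <= t. Proof. by case/andP: t01. Qed.
Let u0 : 0 <= 1 - t. Proof. by rewrite subr_ge0; case/andP: t01. Qed.

Definition mixture : set T -> \bar R :=
  measure_add (mscale (NngNum t0) P) (mscale (NngNum u0) Q).

HB.instance Definition _ := Measure.on mixture.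

Lemma mixtureE A : mixture A = (t%:E * P A + (1 - t)%:E * Q A)%E.
Proof. exact: measure_addE. Qed.

Let mixture_setT : mixture setT = 1%E.
Proof. by rewrite mixtureE !probability_setT !mule1 -EFinD addrC subrK. Qed.

HB.instance Definition _ := Measure_isProbability.Build _ _ _ mixture mixture_setT.

Lemma integral_mixture (f : T -> R) (M : R) : measurable_fun setT f ->
  (forall x, 0 <= f x <= M) ->
  \int[mixture]_x f x = t * \int[P]_x f x + (1 - t) * \int[Q]_x f x.
Proof.
move=> mf fM.
have mf' : measurable_fun setT (EFin \o f) by exact/measurable_EFinP.
have f0 x : setT x -> (0 <= (EFin \o f) x)%E by rewrite lee_fin; case/andP: (fM x).
have fin (S : probability T R) : (\int[S]_x (f x)%:E)%E \is a fin_num.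
  apply: integrable_fin_num => //; apply: (@probability_bounded_integrable _ _ _ _ _ M) => // x.
  by have /andP[h1 h2] := fM x; rewrite ger0_norm.
rewrite /Rintegral ge0_integral_measure_add// !ge0_integral_mscale//=.
by rewrite fineD ?fin_numM// !fineM.
Qed.

End mixture.

(** Moments are affine in the mixture weight, and both coefficients are affine in the moments. *)
Lemma joint_cdf_mixture (R : realType)
    (P Q : probability (measurableTypeR R * measurableTypeR R)%type R) (t : R)
    (t01 : 0 <= t <= 1) :
  uniform_marginals P -> uniform_marginals Q ->
  let C := joint_cdf (mixture P Q t01) in
  [/\ copula C,
   blest C = t * blest (joint_cdf P) + (1 - t) * blest (joint_cdf Q) &
   blest (transpose C) = t * blest (transpose (joint_cdf P)) +
     (1 - t) * blest (transpose (joint_cdf Q))].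
Proof.
move=> uP uQ C.
have mE i j : moment i j (mixture P Q t01) = t * moment i j P + (1 - t) * moment i j Q.
  rewrite /moment (@integral_mixture _ _ _ _ _ _ _ _ 1)//; first exact: measurable_moment.
  move=> w; have /andP[f0 f1] := flip01 w.1; have /andP[g0 g1] := flip01 w.2.
  by rewrite mulr_ge0 ?exprn_ge0// mulr_ile1 ?exprn_ge0 ?exprn_ile1.
split.
- apply: copula_joint_cdf => A mA; have [h1 h2] := uP A mA; have [h3 h4] := uQ A mA.
  have E (x : \bar R) : x \is a fin_num -> (t%:E * x + (1 - t)%:E * x)%E = x.
    by move=> /fineK <-; rewrite -!EFinM -EFinD; congr EFin; ring.
  split; apply: etrans (mixtureE _ _ _ _) _.
  + rewrite (_ : P _ = pushforward P fst A)// (_ : Q _ = pushforward Q fst A)//.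
    by rewrite h1 h3 E// fin_num_measure.
  + rewrite (_ : P _ = pushforward P snd A)// (_ : Q _ = pushforward Q snd A)//.
    by rewrite h2 h4 E// fin_num_measure.
- by rewrite !blest_joint_cdf mE; ring.
- by rewrite !blest_transpose_joint_cdf mE; ring.
Qed.

(** * Consequences of uniform marginals *)

Lemma uniform01_set1 (R : realType) (x : R) :
  uniform01 R ([set x] : set (measurableTypeR R)) = 0%E.
Proof.
have mx : measurable ([set x] : set (measurableTypeR R)) by exact: measurable_set1.
rewrite uniform01E//.
apply: (@subset_measure0 _ _ _ (@lebesgue_measure R) _ [set x]) => //.
- exact: measurableI.
- exact: lebesgue_measure_set1.
Qed.

Section marginals.
Context (R : realType) (P : probability (measurableTypeR R * measurableTypeR R)%type R).
Hypothesis uP : uniform_marginals P.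

Lemma Rintegral_marginal1 (f : R -> R) (M : R) :
  measurable_fun setT f -> (forall x, `|f x| <= M) ->
  \int[P]_w f w.1 = \int[uniform01 R]_x f x.
Proof.
move=> mf fM.
rewrite -(@integral_law _ _ _ _ _ P _ (@measurable_fst _ _ _ _) f M)//.
congr fine; apply: eq_measure_integral => A mA _.
by have [] := uP mA.
Qed.

Lemma Rintegral_marginal2 (f : R -> R) (M : R) :
  measurable_fun setT f -> (forall x, `|f x| <= M) ->
  \int[P]_w f w.2 = \int[uniform01 R]_x f x.
Proof.
move=> mf fM.
rewrite -(@integral_law _ _ _ _ _ P _ (@measurable_snd _ _ _ _) f M)//.
congr fine; apply: eq_measure_integral => A mA _.
by have [] := uP mA.
Qed.

Lemma ae_in_unit_square : {ae P, forall w, 0 <= w.1 <= 1 /\ 0 <= w.2 <= 1}.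
Proof.
exists (~` (`[0, 1] `*` `[0, 1])); split.
- by apply: measurableC; exact: measurableX.
- have mI : measurable (`[0, 1] `*` `[0, 1] : set (measurableTypeR R * measurableTypeR R)).
    exact: measurableX.
  by apply: etrans (probability_setC P mI) _; rewrite uniform_marginals_square// subee.
- move=> w /= h1 [h2 h3]; apply: h1; move: h2 h3.
  by rewrite !in_itv/=.
Qed.

Lemma ae_neq1 (x0 : R) : {ae P, forall w, w.1 != x0}.
Proof.
have m0 : measurable ([set x0] : set (measurableTypeR R)) by exact: measurable_set1.
exists (fst @^-1` [set x0]); split.
- by rewrite -[X in measurable X]setTI; exact: measurable_fst.
- by have [h _] := uP m0; exact: etrans h (uniform01_set1 x0).
- by move=> w /= /negP/negPn/eqP.
Qed.

Lemma ae_neq2 (x0 : R) : {ae P, forall w, w.2 != x0}.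
Proof.
have m0 : measurable ([set x0] : set (measurableTypeR R)) by exact: measurable_set1.
exists (snd @^-1` [set x0]); split.
- by rewrite -[X in measurable X]setTI; exact: measurable_snd.
- by have [_ h] := uP m0; exact: etrans h (uniform01_set1 x0).
- by move=> w /= /negP/negPn/eqP.
Qed.

End marginals.

Lemma measurable_set_le d (T : measurableType d) (R : realType) (f : T -> R) (u : R) :
  measurable_fun setT f -> measurable [set y | f y <= u].
Proof.
move=> mf; rewrite -[X in measurable X]setTI.
exact: (measurable_fun_ler mf (@measurable_cst _ _ _ _ _ u)).
Qed.

(** Almost surely the event on both coordinates is an event on the second one alone, whose law is
    uniform. The right-hand side no longer mentions [P]: this is where uniqueness comes from. *)
Lemma joint_cdf_graph (R : realType)
    (P : probability (measurableTypeR R * measurableTypeR R)%type R) (h : R -> R) :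
  uniform_marginals P -> measurable_fun setT h ->
  {ae P, forall w, w.1 = h w.2} ->
  joint_cdf P = fun u v => fine (uniform01 R ([set y | h y <= u] `&` `]-oo, v])).
Proof.
move=> uP mh hP; apply/funext => u; apply/funext => v; rewrite /joint_cdf.
have mA : measurable ([set y | h y <= u] `&` `]-oo, v] : set (measurableTypeR R)).
  by apply: measurableI => //; exact: measurable_set_le.
have [_ E] := uP _ mA; congr fine; apply: etrans _ E.
have m1 : measurable (`]-oo, u] `*` `]-oo, v] : set (measurableTypeR R * measurableTypeR R)).
  exact: measurableX.
have m2 : measurable (snd @^-1` ([set y | h y <= u] `&` `]-oo, v])
    : set (measurableTypeR R * measurableTypeR R)).
  by rewrite -[X in measurable X]setTI; exact: measurable_snd.
rewrite /pushforward -[LHS]mul1e.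
transitivity (\int[P]_w (\1_(`]-oo, u] `*` `]-oo, v]) w)%:E)%E.
  by rewrite integral_indic// setIT mul1e.
transitivity (\int[P]_w (\1_(snd @^-1` ([set y | h y <= u] `&` `]-oo, v])) w)%:E)%E.
  apply: ae_eq_integral => //; try exact/measurable_EFinP/measurable_indic.
  case: hP => N [mN N0 hN]; exists N; split => // -[x y] /= hw; apply: hN => /= xy.
  apply: hw => _; congr EFin; rewrite !indicE xy; congr (_%:R).
by rewrite integral_indic// setIT.
Qed.

(** * Duality *)

Section extremal.
Context (R : realType) (a b x0 y0 M : R) (T phi : R -> R).
Hypotheses (mT : measurable_fun setT T) (mphi : measurable_fun setT phi).
Hypothesis T01 : forall y, 0 <= y <= 1 -> 0 <= T y <= 1.
Hypothesis phiM : forall x, 0 <= x <= 1 -> `|phi x| <= M.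
Hypothesis supT : superlevel_intervals T.
Hypothesis opt : optimality_certificate (cubic_cost a b) T phi x0 y0.

(** The graph of [T], brought back from the coordinates [x = 1 - u] and [y = 1 - v] to [u] and
    [v]. *)
Definition extremal_map (y : measurableTypeR R) :
  measurableTypeR R * measurableTypeR R := (1 - T y, 1 - y).

Lemma measurable_extremal_map : measurable_fun setT extremal_map.
Proof. by apply: measurable_fun_pair; exact: measurable_funB. Qed.

Definition extremal_law := law (uniform01 R) measurable_extremal_map.

Lemma uniform_marginals_extremal : uniform_marginals extremal_law.
Proof.
move=> A mA; split; first exact: uniform01_preserved.
apply: (uniform01_preserved (h := id)) => // x x01; exists x; split; [lra|lra|].
by move=> y y01; apply/idP/idP; lra.
Qed.

Let gap (w : measurableTypeR R * measurableTypeR R) : R :=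
  duality_gap (cubic_cost a b) T phi (flip w.1) (flip w.2).

Let psi y := cubic_cost a b (T y) y - phi (T y).

Let phiM' u : `|phi (flip u)| <= M. Proof. exact/phiM/flip01. Qed.

Let norm_cubic_cost x y : 0 <= x <= 1 -> 0 <= y <= 1 ->
  `|cubic_cost a b x y| <= `|a| + `|b|.
Proof.
move=> /andP[x1 x2] /andP[y1 y2]; rewrite /cubic_cost (le_trans (ler_normB _ _))//.
rewrite (normrM a) (normrM b); apply: lerD; rewrite ler_piMr// ger0_norm ?mulr_ge0 ?exprn_ge0//;
  by rewrite mulr_ile1 ?exprn_ge0 ?exprn_ile1.
Qed.

Let psiM v : `|psi (flip v)| <= `|a| + `|b| + M.
Proof.
rewrite (le_trans (ler_normB _ _))// lerD ?phiM ?T01 ?flip01//.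
by apply: norm_cubic_cost; [exact/T01/flip01|exact: flip01].
Qed.

Let mcost (f g : R -> R) : measurable_fun setT f -> measurable_fun setT g ->
  measurable_fun setT (fun x => cubic_cost a b (f x) (g x)).
Proof.
move=> mf mg; rewrite /cubic_cost; apply: measurable_funB; apply: measurable_funM => //;
  by apply: measurable_funM => //; exact: measurable_funX.
Qed.

Let mphif : measurable_fun setT (fun u : R => phi (flip u)).
Proof. exact: measurableT_comp mphi (@measurable_flip R). Qed.

Let mpsif : measurable_fun setT (fun u : R => psi (flip u)).
Proof.
have mTf : measurable_fun setT (fun u : R => T (flip u)).
  exact: measurableT_comp mT (@measurable_flip R).
apply: measurable_funB; last exact: measurableT_comp mphi mTf.
by apply: mcost => //; exact: measurable_flip.
Qed.

Let gapE w : gap w = phi (flip w.1) + psi (flip w.2)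
  - (a * (flip w.1 ^+ 2 * flip w.2 ^+ 1) - b * (flip w.1 ^+ 1 * flip w.2 ^+ 2)).
Proof. by rewrite /gap /duality_gap /psi /cubic_cost; ring. Qed.

Let mgap : measurable_fun setT gap.
Proof.
rewrite (_ : gap = fun w => phi (flip w.1) + psi (flip w.2)
  - (a * (flip w.1 ^+ 2 * flip w.2 ^+ 1) - b * (flip w.1 ^+ 1 * flip w.2 ^+ 2))).
  apply: measurable_funB.
    apply: measurable_funD.
      exact: measurableT_comp mphif measurable_fst.
    exact: measurableT_comp mpsif measurable_snd.
  by apply: measurable_funB; apply: measurable_funM => //; exact: measurable_moment.
by apply/funext => w; exact: gapE.
Qed.

Let gap_ge0 w : 0 <= gap w.
Proof. by have [] := opt (flip01 w.1) (flip01 w.2). Qed.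

Let gapM w : `|gap w| <= M + (`|a| + `|b| + M) + (`|a| + `|b|).
Proof.
rewrite gapE (le_trans (ler_normB _ _))// lerD//.
  by rewrite (le_trans (ler_normD _ _))// lerD.
rewrite !expr1; exact: norm_cubic_cost (flip01 _) (flip01 _).
Qed.

(** The value of the dual problem; it depends only on the marginals and is thus common to all
    couplings. *)
Let K : R := \int[uniform01 R]_x phi (flip x) + \int[uniform01 R]_x psi (flip x).

Lemma integral_duality_gap (P : probability (measurableTypeR R * measurableTypeR R)%type R) :
  uniform_marginals P ->
  \int[P]_w gap w = K - (a * moment 2 1 P - b * moment 1 2 P).
Proof.
move=> uP; under eq_Rintegral do rewrite gapE.
have i1 : P.-integrable setT (EFin \o (fun w => phi (flip w.1))).
  apply: (@probability_bounded_integrable _ _ _ _ _ (M)) => [|w]; last exact: phiM'.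
  exact: measurableT_comp mphif measurable_fst.
have i2 : P.-integrable setT (EFin \o (fun w => psi (flip w.2))).
  apply: (@probability_bounded_integrable _ _ _ _ _ (`|a| + `|b| + M)) => [|w]; last exact: psiM.
  exact: measurableT_comp mpsif measurable_snd.
have i3 (c : R) i j : P.-integrable setT (EFin \o (fun w => c * (flip w.1 ^+ i * flip w.2 ^+ j))).
  apply: (@probability_bounded_integrable _ _ _ _ _ (`|c|)) => [|w].
    by apply: measurable_funM => //; exact: measurable_moment.
  by rewrite normrM ler_piMr//; exact: normr_moment_le1.
rewrite RintegralB//; [|exact: (integrableD measurableT i1 i2)|
  exact: (integrableB measurableT (i3 a 2 1)%N (i3 b 1 2)%N)].
rewrite (RintegralD measurableT i1 i2) (RintegralB measurableT (i3 a 2 1)%N (i3 b 1 2)%N).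
rewrite !RintegralZl//; try exact: moment_integrable.
by rewrite (Rintegral_marginal1 uP mphif phiM') (Rintegral_marginal2 uP mpsif psiM).
Qed.

Lemma integral_duality_gap_extremal : \int[extremal_law]_w gap w = 0.
Proof.
rewrite (integral_law _ _ mgap gapM) /Rintegral integral_uniform01//; last 2 first.
- by apply/measurable_EFinP; exact: measurableT_comp mgap measurable_extremal_map.
- by move=> x; rewrite lee_fin.
rewrite integral0_eq// => y /=; rewrite in_itv/= => y01; congr EFin.
have T1 := T01 y01; rewrite /gap /= !flipE; [|lra|lra].
by rewrite !subKr /duality_gap !subrr.
Qed.

(** Complementary slackness: a nonnegative gap of zero integral vanishes almost everywhere, and off
    the two exceptional lines the certificate then places the point on the graph of [T]. *)
Lemma joint_cdf_tight (P : probability (measurableTypeR R * measurableTypeR R)%type R) :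
  uniform_marginals P -> \int[P]_w gap w = 0 -> joint_cdf P = fun u v =>
    fine (uniform01 R ([set y | 1 - T (1 - y) <= u] `&` `]-oo, v])).
Proof.
move=> uP P0; apply: joint_cdf_graph => //.
  apply: measurable_funB => //; apply: measurableT_comp => //; exact: measurable_funB.
have [N [mN N0 hN]] : ae_eq P setT (EFin \o gap) (cst 0%E).
  apply/ae_eq_integral_abs => //; first exact/measurable_EFinP.
  under eq_integral do rewrite /= ger0_norm//.
  rewrite -[LHS]fineK; first by rewrite (_ : fine _ = 0).
  by apply: integrable_fin_num => //; exact: probability_bounded_integrable mgap gapM.
have [N1 [mN1 N10 hN1]] := ae_in_unit_square uP.
(* The exceptional lines [x = x0] and [y = y0] become [u = 1 - x0] and [v = 1 - y0]. *)
have [N2 [mN2 N20 hN2]] := ae_neq1 uP (1 - x0).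
have [N3 [mN3 N30 hN3]] := ae_neq2 uP (1 - y0).
exists (N `|` N1 `|` (N2 `|` N3)); split.
- by apply: measurableU; exact: measurableU.
- by rewrite !measureU0//; exact: measurableU.
move=> w /= hw; apply: contrapT => /not_orP[/not_orP[n0 n1] /not_orP[n2 n3]]; apply: hw.
have /contrapT/(_ I) [g0] := contra_not (hN w) n0.
have /contrapT [w1 w2] := contra_not (hN1 w) n1.
have /contrapT w3 := contra_not (hN2 w) n2.
have /contrapT w4 := contra_not (hN3 w) n3.
have [_ /(_ g0)] := opt (flip01 w.1) (flip01 w.2).
rewrite !flipE// => -[h|h|h]; first lra.
  by case/eqP: w3; lra.
by case/eqP: w4; lra.
Qed.

(** The integral of the gap is [K] minus the cost, nonnegative in general and zero for the extremal
    law. In case of equality both laws are tight and share the same explicit distribution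
    function. *)
Lemma extremal_law_optimal (P : probability (measurableTypeR R * measurableTypeR R)%type R) :
  uniform_marginals P ->
  let c Q := a * moment 2 1 Q - b * moment 1 2 Q in
  c P <= c extremal_law /\
  (c P = c extremal_law -> joint_cdf P = joint_cdf extremal_law).
Proof.
move=> uP c; have uE := uniform_marginals_extremal.
have eP := integral_duality_gap uP.
have eE := integral_duality_gap uE; have e0 := integral_duality_gap_extremal.
have P0 : 0 <= \int[P]_w gap w by apply: Rintegral_ge0 => w _; exact: gap_ge0.
split; first by rewrite /c; lra.
move=> h; rewrite (joint_cdf_tight uE e0) joint_cdf_tight//.
by move: h; rewrite /c; lra.
Qed.

Lemma moment_extremal (i j : nat) :
  moment i j extremal_law =
  \int[@lebesgue_measure R]_(y in `[0, 1]) (T y ^+ i * y ^+ j).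
Proof.
rewrite /moment (integral_law _ _ (@measurable_moment R i j) (@normr_moment_le1 R i j)).
rewrite /Rintegral integral_uniform01; last 2 first.
- apply/measurable_EFinP.
  exact: measurableT_comp (@measurable_moment R i j) measurable_extremal_map.
- move=> y; have /andP[f0 f1] := flip01 (extremal_map y).1.
  have /andP[g0 g1] := flip01 (extremal_map y).2.
  by rewrite lee_fin mulr_ge0 ?exprn_ge0.
congr fine; apply: eq_integral => y; rewrite inE/= in_itv/= => y01; congr EFin.
have T1 := T01 y01; rewrite !flipE; [|lra|lra].
by rewrite !subKr.
Qed.

End extremal.

(** * Moments of the extremal copulas *)

(** Agreement is asked only to the right of [b], so a piecewise integrand may jump at [b] and still
    be replaced by a polynomial on the closed segment. *)
Lemma Rintegral_split (R : realType) (f g : R -> R) (a b c : R) : a <= b <= c ->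
  (@lebesgue_measure R).-integrable `[a, c] (EFin \o f) ->
  (forall x, b < x <= c -> f x = g x) ->
  \int[@lebesgue_measure R]_(x in `[a, c]) f x =
  \int[@lebesgue_measure R]_(x in `[a, b]) f x +
  \int[@lebesgue_measure R]_(x in `[b, c]) g x.
Proof.
move=> /andP[ab bc] fi fg.
have := @Rintegral_itvB _ f (BLeft a) (BRight c) b fi.
rewrite !bnd_simp => /(_ ab bc) E.
rewrite -[LHS](subrK (\int[@lebesgue_measure R]_(x in `[a, b]) f x)) E addrC.
congr (_ + _); rewrite -(Rintegral_itv_obnd_cbnd (f := g)).
  by apply: eq_Rintegral => x; rewrite inE/= in_itv/= => /fg.
have : (@lebesgue_measure R).-integrable `]b, c] (EFin \o f).
  by apply: integrableS fi => //; apply: subset_itv; rewrite bnd_simp.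
apply: eq_integrable => // x; rewrite inE/= in_itv/= => xbc.
by rewrite /= fg.
Qed.

Lemma measurable_T_shift (R : realType) (s : R) : measurable_fun setT (@T_shift R s).
Proof.
apply: measurable_fun_ifT.
- exact: measurable_fun_ler.
- exact: measurable_funD.
- exact: measurable_funB.
Qed.

Lemma measurable_T_fold (R : realType) (b : R) : measurable_fun setT (@T_fold R b).
Proof.
apply: measurable_fun_ifT.
- by apply: measurable_fun_ler => //; exact: measurable_funM.
- by apply: measurable_funM => //; apply: measurable_funD => //; exact: measurable_funM.
apply: measurable_fun_ifT.
- exact: measurable_fun_ler.
- apply: measurable_funB => //; apply: measurable_funM => //.
  by apply: measurable_funB => //; exact: measurable_funM.
- exact: measurable_funB.
Qed.

Lemma measurable_cubic (R : realType) (c0 c1 c2 c3 : R) :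
  measurable_fun setT (fun x : R => c0 + c1 * x + c2 * x ^+ 2 + c3 * x ^+ 3).
Proof.
have mM (c : R) n : measurable_fun setT (fun x : R => c * x ^+ n).
  by apply: measurable_funM => //; exact: exprn_measurable.
apply: measurable_funD (mM c3 3%N); apply: measurable_funD (mM c2 2%N).
exact: measurable_funD (mM c1 1%N).
Qed.

Lemma normr_cubic (R : realType) (c0 c1 c2 c3 x : R) : 0 <= x <= 1 ->
  `|c0 + c1 * x + c2 * x ^+ 2 + c3 * x ^+ 3| <= `|c0| + `|c1| + `|c2| + `|c3|.
Proof.
move=> /andP[x0 x1].
have E (c : R) n : `|c * x ^+ n| <= `|c|.
  by rewrite normrM ler_piMr// ger0_norm ?exprn_ge0// exprn_ile1.
do 3 (rewrite (le_trans (ler_normD _ _))// lerD//).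
exact: (E c1 1%N).
Qed.

(** The common shape of the two potentials, giving measurability and boundedness at once. *)
Definition two_cubics (R : realType) (f : R -> R) := exists d c0 c1 c2 c3 e0 e1 e2 e3 : R,
  forall x, f x = if x <= d then c0 + c1 * x + c2 * x ^+ 2 + c3 * x ^+ 3
                  else e0 + e1 * x + e2 * x ^+ 2 + e3 * x ^+ 3.

Lemma measurable_two_cubics (R : realType) (f : R -> R) : two_cubics f -> measurable_fun setT f.
Proof.
move=> [d [c0 [c1 [c2 [c3 [e0 [e1 [e2 [e3 /funext ->]]]]]]]]].
by apply: measurable_fun_ifT; [exact: measurable_fun_ler|exact: measurable_cubic..].
Qed.

Lemma bounded_two_cubics (R : realType) (f : R -> R) : two_cubics f ->
  exists M, forall x, 0 <= x <= 1 -> `|f x| <= M.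
Proof.
move=> [d [c0 [c1 [c2 [c3 [e0 [e1 [e2 [e3 E]]]]]]]]].
exists ((`|c0| + `|c1| + `|c2| + `|c3|) + (`|e0| + `|e1| + `|e2| + `|e3|)) => x x01.
by rewrite E; case: ifP => _; 
  rewrite (le_trans (normr_cubic _ _ _ _ x01))// ?lerDl ?lerDr !addr_ge0.
Qed.

Lemma two_cubics_phi_shift (R : realType) (s : R) : two_cubics (phi_shift s).
Proof.
pose A := 2 * s; pose B := 3 - 2 * s; pose d := 1 - s.
exists d, (B - (A * (3 * d ^+ 2 - 2 * d ^+ 3) + B * s ^+ 3)), (- (3 * B)),
  (3 * A + 3 * B), (- (2 * A) - B).
exists (- (2 * A - B) * d ^+ 3 + 3 * A * d ^+ 3),
  (3 * (2 * A - B) * d ^+ 2 - 6 * A * d ^+ 2),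
  (- (3 * (2 * A - B) * d) + 3 * A * d), (2 * A - B).
by move=> x; rewrite /phi_shift -/d; case: ifP => _; rewrite /A /B; ring.
Qed.

Lemma two_cubics_phi_fold (R : realType) (b : R) : two_cubics (phi_fold b).
Proof.
pose d := 1 - b; pose e := 1 - 2 * b.
exists d, (4 * d ^+ 2 - 2 * d * (b * (3 * d ^+ 2 - 2 * d ^+ 3) + 2 * d * b ^+ 3)),
  (- (12 * d ^+ 2)), (6 * d * b + 12 * d ^+ 2), (- (4 * d * b) - 4 * d ^+ 2).
exists (3 * b * d ^+ 3 + e * d ^+ 3), (- (6 * b * d ^+ 2) - 3 * e * d ^+ 2),
  (3 * b * d + 3 * e * d), (- e).
by move=> x; rewrite /phi_fold -/d; case: ifP => _; rewrite -/e; ring.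
Qed.

Lemma T_shift01 (R : realFieldType) (s y : R) : 1 / 2 <= s <= 1 -> 0 <= y <= 1 ->
  0 <= T_shift s y <= 1.
Proof. by move=> hs hy; rewrite /T_shift; case: (leP y s); lra. Qed.

Lemma T_fold01 (R : realFieldType) (b y : R) : 0 <= b < 1 / 2 -> 0 <= y <= 1 ->
  0 <= T_fold b y <= 1.
Proof.
move=> hb hy; case: T_foldP => // [h1 h2|t h1 h2 h3|h1]; [| |lra].
  have : 0 <= (1 - b) * y by apply: mulr_ge0; lra.
  by have : 0 <= b * (1 - b); [apply: mulr_ge0|]; lra.
have e0 : 0 < 1 - 2 * b by lra.
have h4 : (1 - 2 * b) * (1 - t) <= (1 - 2 * b) * b.
  have : 0 <= (1 - b) * (b - y) by apply: mulr_ge0; lra.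
  lra.
rewrite ler_pM2l// in h4.
have : 0 <= 1 - t by rewrite -(pmulr_rge0 _ e0); lra.
lra.
Qed.

Lemma transport_integrable (R : realType) (T : R -> R) (i j : nat) (a b : R) :
  measurable_fun setT T -> (forall y, 0 <= y <= 1 -> 0 <= T y <= 1) ->
  0 <= a -> b <= 1 ->
  (@lebesgue_measure R).-integrable `[a, b] (EFin \o (fun y => T y ^+ i * y ^+ j)).
Proof.
move=> mT T01 a0 b1; apply: measurable_bounded_integrable => //.
- have E : (@lebesgue_measure R `[a, b] < +oo)%E.
    by rewrite lebesgue_measure_itv/=; case: ifP => _; rewrite ?ltry// -EFinD ltry.
  exact: E.
- apply: measurable_funTS; apply: measurable_funM; last exact: exprn_measurable.
  exact: measurable_funX.
- exists 1; split => // M M1 y; rewrite /= in_itv/= => /andP[y1 y2].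
  have y01 : 0 <= y <= 1 by lra.
  have /andP[t0 t1] := T01 _ y01; move: y01 => /andP[y3 y4].
  apply: le_trans _ (ltW M1); rewrite ger0_norm ?mulr_ge0 ?exprn_ge0//.
  by rewrite mulr_ile1 ?exprn_ge0 ?exprn_ile1.
Qed.

Lemma T_shift_moments (R : realType) (s : R) : 1 / 2 <= s <= 1 ->
  \int[@lebesgue_measure R]_(y in `[0, 1]) (T_shift s y ^+ 2 * y ^+ 1) =
    1 / 12 + s ^+ 3 / 6 + s ^+ 3 * (1 - s) / 6 /\
  \int[@lebesgue_measure R]_(y in `[0, 1]) (T_shift s y ^+ 1 * y ^+ 2) =
    1 / 12 + s ^+ 3 / 6 - s ^+ 3 * (1 - s) / 6.
Proof.
move=> hs; have T01 y := @T_shift01 R s y hs.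
have I i j := transport_integrable i j (measurable_T_shift s) T01 (lexx 0) (lexx 1).
have s01 : 0 <= s <= 1 by lra.
have s0 : 0 <= s by lra.
have s1 : s <= 1 by lra.
split.
- rewrite (Rintegral_split (g := fun y => 0 + 1 * y + (-2) * y ^+ 2 + 1 * y ^+ 3) s01 (I _ _)).
    rewrite integral_cubic//.
    transitivity (\int[@lebesgue_measure R]_(y in `[0, s])
      (0 + (1 - s) ^+ 2 * y + 2 * (1 - s) * y ^+ 2 + 1 * y ^+ 3) +
      (0 * (1 - s) + 1 / 2 * (1 ^+ 2 - s ^+ 2) + -2 / 3 * (1 ^+ 3 - s ^+ 3) +
     1 / 4 * (1 ^+ 4 - s ^+ 4))).
      congr (_ + _); apply: eq_Rintegral => y; rewrite inE/= in_itv/= => /andP[_ ys].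
      by rewrite /T_shift ys; ring.
    by rewrite integral_cubic//; field.
  by move=> y /andP[ys y1]; rewrite /T_shift leNgt ys/=; ring.
- rewrite (Rintegral_split (g := fun y => 0 + 0 * y + 1 * y ^+ 2 + (-1) * y ^+ 3) s01 (I _ _)).
    rewrite integral_cubic//.
    transitivity (\int[@lebesgue_measure R]_(y in `[0, s])
      (0 + 0 * y + (1 - s) * y ^+ 2 + 1 * y ^+ 3) +
      (0 * (1 - s) + 0 / 2 * (1 ^+ 2 - s ^+ 2) + 1 / 3 * (1 ^+ 3 - s ^+ 3) +
     -1 / 4 * (1 ^+ 4 - s ^+ 4))).
      congr (_ + _); apply: eq_Rintegral => y; rewrite inE/= in_itv/= => /andP[_ ys].
      by rewrite /T_shift ys; ring.
    by rewrite integral_cubic//; field.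
  by move=> y /andP[ys y1]; rewrite /T_shift leNgt ys/=; ring.
Qed.

(** The source of the parametric formulas: after multiplication by [12] and subtraction of [2], the
    half-sum of the moments is the abscissa and their half-difference the ordinate. *)
Lemma T_fold_moments (R : realType) (b : R) : 0 <= b < 1 / 2 ->
  \int[@lebesgue_measure R]_(y in `[0, 1]) (T_fold b y ^+ 2 * y ^+ 1) =
    (2 + Upsilon_abscissa b + Upsilon_ordinate b) / 12 /\
  \int[@lebesgue_measure R]_(y in `[0, 1]) (T_fold b y ^+ 1 * y ^+ 2) =
    (2 + Upsilon_abscissa b - Upsilon_ordinate b) / 12.
Proof.
move=> hb; have T01 y := @T_fold01 R b y hb.
have I i j c := @transport_integrable R _ i j 0 c (measurable_T_fold b) T01 (lexx 0).
have b01 : 0 <= b <= 1 by lra.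
have b0 : 0 <= b by lra.
have b1 : b <= 1 by lra.
have d0 : 2 * (1 - b) != 0 by lra.
have dp : 0 < 2 * (1 - b) by lra.
set k := b / (2 * (1 - b)).
have kE : 2 * (1 - b) * k = b by rewrite mulrC divfK.
have k0 : 0 <= k by rewrite divr_ge0//; lra.
have kb : k <= b.
  rewrite ler_pdivrMr//; have : 0 <= b * (1 - 2 * b) by apply: mulr_ge0; lra.
  lra.
have k0b : 0 <= k <= b by rewrite k0 kb.
have T1 y : y <= k -> T_fold b y = (1 - b) * (1 + 2 * y).
  by move=> yk; rewrite /T_fold -[X in _ <= X]kE ler_pM2l// yk.
have T2 y : k < y -> y <= b -> T_fold b y = (1 - b) / (1 - 2 * b) * (1 - 2 * y).
  move=> yk yb; rewrite /T_fold -[X in _ <= X]kE ler_pM2l// leNgt yk/= yb.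
  by field; lra.
have T3 y : b < y -> T_fold b y = 1 - y.
  move=> yb; have yk : k < y by exact: le_lt_trans kb yb.
  by rewrite /T_fold -[X in _ <= X]kE ler_pM2l// leNgt yk/= leNgt yb.
split.
- rewrite (Rintegral_split (g := fun y => 0 + 1 * y + (-2) * y ^+ 2 + 1 * y ^+ 3) b01
    (I _ _ _ (lexx 1))); last first.
    by move=> y /andP[ys y1]; rewrite T3//; ring.
  pose e2 := ((1 - b) / (1 - 2 * b)) ^+ 2.
  rewrite (Rintegral_split (g := fun y => 0 + e2 * y + (- 4 * e2) * y ^+ 2 + (4 * e2) * y ^+ 3)
    k0b (I _ _ _ b1)); last first.
    by move=> y /andP[y1 y2]; rewrite T2// /e2; ring.
  rewrite !integral_cubic//.
  have -> : \int[@lebesgue_measure R]_(y in `[0, k]) (T_fold b y ^+ 2 * y ^+ 1) =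
      \int[@lebesgue_measure R]_(y in `[0, k])
      (0 + (1 - b) ^+ 2 * y + 4 * (1 - b) ^+ 2 * y ^+ 2 + 4 * (1 - b) ^+ 2 * y ^+ 3).
    by apply: eq_Rintegral => y; rewrite inE/= in_itv/= => /andP[_ ys]; rewrite T1//; ring.
  rewrite integral_cubic// /e2 /k /Upsilon_abscissa /Upsilon_ordinate; field.
  by apply/andP; split; lra.
- rewrite (Rintegral_split (g := fun y => 0 + 0 * y + 1 * y ^+ 2 + (-1) * y ^+ 3) b01
    (I _ _ _ (lexx 1))); last first.
    by move=> y /andP[ys y1]; rewrite T3//; ring.
  pose e1 := (1 - b) / (1 - 2 * b).
  rewrite (Rintegral_split (g := fun y => 0 + 0 * y + e1 * y ^+ 2 + (- 2 * e1) * y ^+ 3)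
    k0b (I _ _ _ b1)); last first.
    by move=> y /andP[y1 y2]; rewrite T2// -/e1; ring.
  rewrite !integral_cubic//.
  have -> : \int[@lebesgue_measure R]_(y in `[0, k]) (T_fold b y ^+ 1 * y ^+ 2) =
      \int[@lebesgue_measure R]_(y in `[0, k])
      (0 + 0 * y + (1 - b) * y ^+ 2 + 2 * (1 - b) * y ^+ 3).
    by apply: eq_Rintegral => y; rewrite inE/= in_itv/= => /andP[_ ys]; rewrite T1//; ring.
  rewrite integral_cubic// /e1 /k /Upsilon_abscissa /Upsilon_ordinate; field.
  by apply/andP; split; lra.
Qed.

(** * The boundary curve *)

(** Translates optimality for the cost into an inequality between coefficients, since these are [12]
    times the moments minus [2]. It turns each certificate into a supporting line of the region. *)
Lemma transport_optimal (R : realType) (a b x0 y0 e n : R) (T phi : R -> R) :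
  measurable_fun setT T -> two_cubics phi ->
  (forall y, 0 <= y <= 1 -> 0 <= T y <= 1) -> superlevel_intervals T ->
  optimality_certificate (cubic_cost a b) T phi x0 y0 ->
  \int[@lebesgue_measure R]_(y in `[0, 1]) (T y ^+ 2 * y ^+ 1) = (2 + e + n) / 12 ->
  \int[@lebesgue_measure R]_(y in `[0, 1]) (T y ^+ 1 * y ^+ 2) = (2 + e - n) / 12 ->
  exists C : R -> R -> R, [/\ copula C, sym_blest C = e, blest C = e + n &
    forall D, copula D ->
      a * blest D - b * blest (transpose D) <= a * (e + n) - b * (e - n) /\
      (a * blest D - b * blest (transpose D) = a * (e + n) - b * (e - n) -> D = C)].
Proof.
move=> mT cphi T01 supT opt m21 m12.
have mphi := measurable_two_cubics cphi.
have [M phiM] := bounded_two_cubics cphi.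
have uE := uniform_marginals_extremal mT supT.
rewrite -(moment_extremal mT T01) in m21; rewrite -(moment_extremal mT T01) in m12.
exists (joint_cdf (extremal_law mT)); split.
- exact: copula_joint_cdf.
- by rewrite /sym_blest blest_joint_cdf blest_transpose_joint_cdf m21 m12; field.
- by rewrite blest_joint_cdf m21; field.
move=> _ [P [_ uP ->]].
have [le_c eq_c] := extremal_law_optimal mT mphi T01 phiM supT opt uP.
rewrite blest_joint_cdf blest_transpose_joint_cdf; rewrite m21 m12 in le_c eq_c.
by split => [|h]; [lra|apply: eq_c; lra].
Qed.

Lemma blest_transpose (R : realType) (D : R -> R -> R) :
  blest (transpose D) = 2 * sym_blest D - blest D.
Proof. by rewrite /sym_blest; move: (blest _) (blest _) => x y; field. Qed.

Definition maximal_copula (R : realType) (e n : R) (C : R -> R -> R) :=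
  [/\ copula C, sym_blest C = e, blest C = n & forall D, copula D ->
     sym_blest D = e -> blest D <= n /\ (blest D = n -> D = C)].

(** Once [sym_blest D = e] is fixed, [blest (transpose D)] is [2 * e - blest D], and the functional
    becomes [(a + b) * blest D] minus a constant, increasing in [blest D]. *)
Lemma maximal_copula_of_optimal (R : realType) (a b e n : R) (C : R -> R -> R) :
  0 < a + b -> copula C -> sym_blest C = e -> blest C = e + n ->
  (forall D, copula D ->
      a * blest D - b * blest (transpose D) <= a * (e + n) - b * (e - n) /\
      (a * blest D - b * blest (transpose D) = a * (e + n) - b * (e - n) -> D = C)) ->
  maximal_copula e (e + n) C.
Proof.
move=> ab cC sC bC hD; split=> // D cD sD; have [le_D eq_D] := hD D cD.
rewrite blest_transpose sD in le_D eq_D.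
move: (blest D) le_D eq_D => x le_D eq_D.
split; last by move=> h; apply: eq_D; rewrite h; ring.
by rewrite -(ler_pM2l ab); move: le_D; clear; lra.
Qed.

Lemma shift_optimal (R : realType) (s : R) : 1 / 2 <= s <= 1 ->
  let e := 2 * s ^+ 3 - 1 in let n := 2 * s ^+ 3 * (1 - s) in
  let a := 6 * s in let b := 3 * (3 - 2 * s) in
  exists C : R -> R -> R, [/\ copula C, sym_blest C = e, blest C = e + n &
    forall D, copula D ->
      a * blest D - b * blest (transpose D) <= a * (e + n) - b * (e - n) /\
      (a * blest D - b * blest (transpose D) = a * (e + n) - b * (e - n) -> D = C)].
Proof.
move=> hs e n a b; have [m21 m12] := T_shift_moments hs.
apply: (transport_optimal (measurable_T_shift s) (two_cubics_phi_shift s) _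
  (T_shift_superlevel hs) (T_shift_optimal hs)).
- by move=> y; exact: T_shift01.
- by rewrite m21 /e /n; field.
- by rewrite m12 /e /n; field.
Qed.

Lemma fold_optimal (R : realType) (b : R) : 0 <= b < 1 / 2 ->
  let e := Upsilon_abscissa b in let n := Upsilon_ordinate b in
  let a' := 6 * b * (1 - b) in let b' := 12 * (1 - b) ^+ 2 in
  exists C : R -> R -> R, [/\ copula C, sym_blest C = e, blest C = e + n &
    forall D, copula D ->
      a' * blest D - b' * blest (transpose D) <= a' * (e + n) - b' * (e - n) /\
      (a' * blest D - b' * blest (transpose D) = a' * (e + n) - b' * (e - n) -> D = C)].
Proof.
move=> hb e n a' b'; have [m21 m12] := T_fold_moments hb.
apply: (transport_optimal (measurable_T_fold b) (two_cubics_phi_fold b) _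
  (T_fold_superlevel hb) (T_fold_optimal hb)) => //.
by move=> y; exact: T_fold01.
Qed.

Lemma transposeK (R : realType) (C : R -> R -> R) : transpose (transpose C) = C.
Proof. by []. Qed.

Lemma sym_blest_transpose (R : realType) (C : R -> R -> R) :
  sym_blest (transpose C) = sym_blest C.
Proof. rewrite /sym_blest -[X in _ + blest X]/C; move: (blest _) (blest _) => x y.
by rewrite addrC. Qed.

(** The end parameters [b = 0] and [s = 1] have ordinate zero. Their inequalities, written for [D]
    and for its transpose and then added, give the two bounds. *)
Lemma sym_blest_bounds (R : realType) (D : R -> R -> R) : copula D ->
  - 1 <= sym_blest D <= 1.
Proof.
move=> cD; have cDt := copula_transpose cD.
have [|C1 [_ _ _ h1]] := @fold_optimal R 0; first lra.
have [|C2 [_ _ _ h2]] := @shift_optimal R 1; first lra.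
have [l1 _] := h1 _ cD; have [l2 _] := h1 _ cDt.
have [l3 _] := h2 _ cD; have [l4 _] := h2 _ cDt.
rewrite transposeK in l2 l4; rewrite /sym_blest.
move: (blest (transpose D)) (blest D) l1 l2 l3 l4 => x y.
rewrite /Upsilon_abscissa /Upsilon_ordinate !expr0n/= !(mul0r, mulr0, addr0, subr0) expr1n.
by rewrite subrr !mulr0; lra.
Qed.

(** * [Upsilon] along the two families *)

Lemma Upsilon_shift (R : realType) (s : R) : 1 / 2 <= s <= 1 ->
  Upsilon (2 * s ^+ 3 - 1) = 2 * s ^+ 3 * (1 - s).
Proof.
move=> /andP[s12 s1]; have s0 : 0 <= s by lra.
have s3 : 1 / 8 <= s ^+ 3.
  have : (1 / 2) ^+ 3 <= s ^+ 3 :> R by rewrite lerXn2r// nnegrE; lra.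
  lra.
rewrite /Upsilon ifF; last by apply/eqP; lra.
rewrite ifT; last lra.
have -> : 1 + (2 * s ^+ 3 - 1) = 2 * s ^+ 3 by ring.
(* The exponents of [2] add up to [1] and [s ^+ 3] is raised to [4 / 3], so the power term is
   [2 * s ^+ 4]. *)
rewrite powRM ?exprn_ge0// mulrA -powRD; last by apply/implyP => _; rewrite pnatr_eq0.
have -> : - (1 / 3) + 4 / 3 = 1 :> R by field.
rewrite powRr1// -powR_mulrn// -powRrM.
have -> : 3%:R * (4 / 3) = 4%:R :> R by field.
by rewrite !powR_mulrn//; ring.
Qed.

(** Intermediate values for the equation cleared of its denominator: the polynomial is negative at
    [0] because [-1 < e] and positive at [1 / 2] because [e < - (3 / 4)], which also excludes the
    endpoints. *)
Lemma Upsilon_abscissa_surj (R : realType) (e : R) : - 1 < e < - (3 / 4) ->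
  exists b : R, 0 < b < 1 / 2 /\ Upsilon_abscissa b = e.
Proof.
move=> he.
pose p : {poly R} := 'X^3 * (2 *: 'X^2 - 9 *: 'X + 8%:P) - (8 * (1 + e)) *: (1 - 'X) ^+ 2.
have pE x : p.[x] = x ^+ 3 * (2 * x ^+ 2 - 9 * x + 8) - 8 * (1 + e) * (1 - x) ^+ 2.
  by rewrite /p !hornerE /=; ring.
have [||x /andP[x0 x1]] := @poly_ivt _ p 0 (1 / 2); first lra.
  by rewrite !pE; apply/andP; split; lra.
rewrite /root pE => /eqP px.
have xn0 : x != 0 by apply/eqP => x0'; move: px; rewrite x0'; lra.
have xn1 : x != 1 / 2 by apply/eqP => x0'; move: px; rewrite x0'; lra.
exists x; split; first by rewrite !lt_neqAle eq_sym xn0 x0 xn1 x1.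
have x1' : x != 1 by apply/eqP; lra.
rewrite /Upsilon_abscissa
  (_ : x ^+ 3 * (2 * x ^+ 2 - 9 * x + 8) = 8 * (1 + e) * (1 - x) ^+ 2); last lra.
by field; lra.
Qed.

Lemma Upsilon_param (R : realType) (e : R) : - 1 <= e <= 1 ->
  (exists2 s : R, 1 / 2 <= s <= 1 & e = 2 * s ^+ 3 - 1 /\ Upsilon e = 2 * s ^+ 3 * (1 - s)) \/
  (exists2 b : R, 0 <= b < 1 / 2 & e = Upsilon_abscissa b /\ Upsilon e = Upsilon_ordinate b).
Proof.
move=> he; have [e34|e34] := leP (- (3 / 4)) e.
  left; pose t := (1 + e) / 2; pose s := t `^ (1 / 3).
  have t0 : 0 <= t by rewrite /t; lra.
  have sE : s ^+ 3 = t.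
    by rewrite -powR_mulrn ?powR_ge0// -powRrM (_ : 1 / 3 * 3%:R = 1) ?powRr1//; field.
  have s0 : 0 <= s by exact: powR_ge0.
  have hs : 1 / 2 <= s <= 1.
    apply/andP; split.
      rewrite -(@ler_pXn2r _ 3)// ?nnegrE//.
      by rewrite sE /t; lra.
    by rewrite -(@ler_pXn2r _ 3)// ?nnegrE// sE /t; lra.
  have eE : e = 2 * s ^+ 3 - 1 by rewrite sE /t; lra.
  by exists s => //; split => //; rewrite {1}eE Upsilon_shift.
right; have [e1|e1] := eqVneq e (- 1).
  exists 0; first lra.
  by rewrite /Upsilon e1 eqxx /Upsilon_abscissa /Upsilon_ordinate !expr0n/= !(mul0r, addr0).
have [|b0 hb0] := @Upsilon_abscissa_surj R e.
  by rewrite lt_neqAle eq_sym e1 e34; case/andP: he => ->.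
pose B := [set b : R | 0 < b < 1 / 2 /\ Upsilon_abscissa b = e].
(* As a preimage exists, [xget] returns one rather than its default value, and that one serves as
   the parameter. *)
have [hb bE] := xgetPex 0 (ex_intro B b0 hb0).
exists (xget 0 B); first lra.
by rewrite bE /Upsilon (negbTE e1) leNgt e34.
Qed.

Lemma Upsilon_bounds (R : realType) (e : R) : - 1 <= e <= 1 ->
  0 <= Upsilon e <= 27 / 128.
Proof.
move=> /Upsilon_param [[s hs [_ ->]]|[b hb [_ ->]]].
  have h1 : 0 <= s ^+ 3 * (1 - s) by rewrite mulr_ge0 ?exprn_ge0//; lra.
  (* This product is [128] times [27 / 128 - 2 * s ^+ 3 * (1 - s)]; the bound is attained at
     [s = 3 / 4]. *)
  have h2 : 0 <= (4 * s - 3) ^+ 2 * (16 * s ^+ 2 + 8 * s + 3).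
    apply: mulr_ge0; first exact: sqr_ge0.
    by have := sqr_ge0 s; lra.
  by apply/andP; split; lra.
have d0 : 0 < 8 * (1 - b) ^+ 2 by rewrite mulr_gt0// exprn_gt0//; lra.
have q0 : 0 <= 6 * b ^+ 2 - 15 * b + 8 by have := sqr_ge0 b; lra.
rewrite /Upsilon_ordinate; apply/andP; split.
  by rewrite divr_ge0 ?mulr_ge0 ?exprn_ge0 ?(ltW d0)//; lra.
rewrite ler_pdivrMr//.
(* The numerator is [8 * b ^+ 3 - 12 * b ^+ 4] minus [3 * (b ^+ 4 - 2 * b ^+ 5)]. It is at most
   [1 / 4], hence at most [(1 - b) ^+ 2], so the ordinate is at most [1 / 8]. *)
have b1 : 1 / 4 <= (1 - b) ^+ 2.
  have : 0 <= (1 - 2 * b) * (3 - 2 * b) by apply: mulr_ge0; lra.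
  lra.
have h1 : 0 <= b ^+ 3 * (b * (1 - 2 * b)).
  by rewrite mulr_ge0 ?exprn_ge0// ?mulr_ge0//; lra.
have h2 : 0 <= (1 - 2 * b) ^+ 2 * (1 / 4 + b + 3 * b ^+ 2).
  by apply: mulr_ge0; [exact: sqr_ge0|have := sqr_ge0 b; lra].
lra.
Qed.

Lemma maximal_copula_exists (R : realType) (e : R) : - 1 <= e <= 1 ->
  exists C, maximal_copula e (e + Upsilon e) C.
Proof.
move=> /Upsilon_param [[s hs [eE ->]]|[b hb [eE ->]]].
  have [C [h1 h2 h3 h4]] := shift_optimal hs; exists C; rewrite eE.
  by apply: (maximal_copula_of_optimal _ h1 h2 h3 h4); lra.
have [C [h1 h2 h3 h4]] := fold_optimal hb; exists C; rewrite eE.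
apply: (maximal_copula_of_optimal _ h1 h2 h3 h4).
apply: ltr_wpDl; first by rewrite !mulr_ge0//; lra.
by rewrite mulr_gt0// exprn_gt0//; lra.
Qed.

(** * The exact region and its boundary copulas *)

Lemma convex_weight (R : realFieldType) (e n U : R) : `|n - e| <= U ->
  exists2 t : R, 0 <= t <= 1 & n = t * (e + U) + (1 - t) * (e - U).
Proof.
rewrite ler_norml => hn; have [U0|U0] := eqVneq U 0.
  by exists 0; [|rewrite U0 in hn *]; lra.
have Upos : 0 < U by rewrite lt_neqAle eq_sym U0; lra.
exists ((n - (e - U)) / (2 * U)); last by field.
by rewrite divr_ge0 ?ler_pdivrMr ?mul1r; lra.
Qed.

Theorem theorem1p2 (R : realType) :
  (forall e : R, - 1 <= e <= 1 -> 0 <= Upsilon e <= 27 / 128) /\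
  [set (sym_blest C, blest C) | C in @copula R] =
    [set p : R * R | - 1 <= p.1 <= 1 /\ `|p.2 - p.1| <= Upsilon p.1] /\
  (forall e : R, - 1 <= e <= 1 ->
     exists C : R -> R -> R,
       unique (fun D : R -> R -> R =>
         [/\ copula D, sym_blest D = e & blest D = e + Upsilon e]) C /\
       unique (fun D : R -> R -> R =>
         [/\ copula D, sym_blest D = e & blest D = e - Upsilon e])
         (transpose C)).
Proof.
split; [exact: Upsilon_bounds|split].
  apply/seteqP; split => [_ [D cD <-] /=|[e n] /= [he hn]].
    have he := sym_blest_bounds cD; split=> //.
    have [C [_ _ _ maxC]] := maximal_copula_exists he.
    have [h1 _] := maxC D cD erefl.
    (* The upper bound for the transpose is the lower bound for [D]. *)
    have [h2 _] := maxC _ (copula_transpose cD) (sym_blest_transpose D).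
    rewrite blest_transpose in h2; rewrite ler_norml.
    by move: (sym_blest D) (blest D) (Upsilon _) h1 h2 {maxC} => x y z; clear; lra.
  have [C [[P [_ uP ->]] sC bC _]] := maximal_copula_exists he.
  have bCt : blest (transpose (joint_cdf P)) = e - Upsilon e.
    by rewrite blest_transpose sC bC; clear; ring.
  (* The maximal copula and its transpose are the ends of the vertical segment over [e]; mixing them
     reaches every point between. *)
  have [t t01 ->] := convex_weight hn.
  have [cM bM bMt] := joint_cdf_mixture t01 uP (uniform_marginals_transpose uP).
  rewrite -transpose_joint_cdf (transposeK (joint_cdf P)) bC bCt in bM bMt.
  exists (joint_cdf (mixture P (transpose_law P) t01)) => //.
  by rewrite /sym_blest bM bMt; congr (_, _); clear; field.
move=> e he; have [C [cC sC bC maxC]] := maximal_copula_exists he.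
exists C; split; split.
- by [].
- by move=> D [cD sD bD]; have [_ /(_ bD)] := maxC D cD sD.
- split; [exact: copula_transpose|by rewrite sym_blest_transpose|].
  by rewrite blest_transpose sC bC; ring.
- move=> D [cD sD bD].
  (* A copula on the lower boundary has its transpose on the upper one, where uniqueness is
     known. *)
  have [|_ <-] := maxC (transpose D) (copula_transpose cD).
  + by rewrite sym_blest_transpose.
  + by [].
  + by rewrite blest_transpose sD bD; ring.
Qed.
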